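(* Let $H$ be a $k$-uniform hypergraph, and let $d,t,D$ be fixed positive integers. Then $H$-freeness is easily testable with respect to the family $\mathcal{F}$ of $k$-uniform semi-algebraic hypergraphs in $\mathbb{R}^d$ with complexity $(t,D)$.
   Context: A $k$-uniform hypergraph is $(P,E)$ with finite vertex set $P$ and $E$ a set of $k$-element subsets of $P$, regarded as a symmetric relation on $P$. $H$-freeness is the property of $k$-uniform hypergraphs of not containing $H$ as a subhypergraph. A $k$-uniform hypergraph $(P,E)$ with $P=\{p_1,\dots,p_n\}\subset\mathbb{R}^d$ is semi-algebraic in $\mathbb{R}^d$ with complexity $(t,D)$ if there are polynomials $f_1,\dots,f_t\in\mathbb{R}[x_1,\dots,x_{kd}]$ (viewed as functions of $k$ points of $\mathbb{R}^d$) and a Boolean function $\Phi$ such that for every $1\le i_1<\cdots<i_k\le n$: $(p_{i_1},\dots,p_{i_k})\in E$ if and only if for all permutations $\pi$ of the indices, $\Phi\big(f_1(p_{\pi(i_1)},\dots,p_{\pi(i_k)})\ge0,\dots,f_t(p_{\pi(i_1)},\dots,p_{\pi(i_k)})\ge0\big)=1$; and, for every $1\le j\le t$ and any fixed $q_1,\dots,q_{k-1}\in\mathbb{R}^d$, each of the $k$ $d$-variate polynomials $f_j(\mathbf{x},q_1,\dots,q_{k-1}),\ f_j(q_1,\mathbf{x},q_2,\dots,q_{k-1}),\dots,f_j(q_1,\dots,q_{k-1},\mathbf{x})$ has degree at most $D$. Property testing: a property $\mathcal{P}$ is a family of $k$-uniform hypergraphs closed under isomorphism. A hypergraph $G$ is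 $\epsilon$-far from satisfying $\mathcal{P}$ if one must change the adjacency relation of at least an $\epsilon$ fraction of all $k$-tuples of vertices in order to turn $G$ into a hypergraph satisfying $\mathcal{P}$. An $\epsilon$-tester for $\mathcal{P}$ with respect to a family $\mathcal{F}$ is a randomized algorithm which, given the number $n$ of vertices and the ability to query whether a given $k$-tuple of vertices is an edge, distinguishes with probability at least $2/3$ between the cases that $G$ satisfies $\mathcal{P}$ and that $G$ is $\epsilon$-far from satisfying $\mathcal{P}$, for every $G\in\mathcal{F}$. It is one-sided if, whenever $G\in\mathcal{F}$ satisfies $\mathcal{P}$, the tester outputs this with probability $1$. $\mathcal{P}$ is easily testable with respect to $\mathcal{F}$ if for every fixed $\epsilon>0$ there is a one-sided $\epsilon$-tester for $\mathcal{P}$ with respect to $\mathcal{F}$ whose query complexity is bounded by a function of $\epsilon$ only (independent of the size of the input), and this query complexity is polynomial in $\epsilon^{-1}$. *)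

(* Defs.v *)
From mathcomp Require Import all_boot all_order all_algebra.
From mathcomp Require Import perm reals mpoly.

Set Implicit Arguments.
Unset Strict Implicit.
Unset Printing Implicit Defensive.

Import Order.TTheory GRing.Theory Num.Theory.
Local Open Scope ring_scope.

Record hypergraph (k : nat) (V : finType) : Type := Hypergraph {
  edges : {set {set V}};
  edges_uniform : [forall e in edges, #|e| == k]
}.

(* A tuple with a repeated vertex spans fewer than k vertices, hence is never
   adjacent. *)
Definition adjacent (k : nat) (V : finType) (G : hypergraph k V)
    (u : k.-tuple V) : bool :=
  [set x in u] \in edges G.

Definition isomorphic (k : nat) (V W : finType)
    (G : hypergraph k V) (G' : hypergraph k W) : Prop :=
  exists2 phi : V -> W, bijective phi &
    forall e : {set V}, (phi @: e \in edges G') = (e \in edges G).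

Record hproperty (k : nat) : Type := HProperty {
  satisfies :> forall V : finType, hypergraph k V -> Prop;
  satisfies_iso : forall (V W : finType)
    (G : hypergraph k V) (G' : hypergraph k W),
    isomorphic G G' -> satisfies G -> satisfies G'
}.

(* The embedding need not be induced. *)
Definition contains (k : nat) (U V : finType)
    (H : hypergraph k U) (G : hypergraph k V) : Prop :=
  exists2 phi : U -> V, injective phi &
    forall e : {set U}, e \in edges H -> phi @: e \in edges G.

Lemma not_contains_iso (k : nat) (U : finType) (H : hypergraph k U)
    (V W : finType) (G : hypergraph k V) (G' : hypergraph k W) :
  isomorphic G G' -> ~ contains H G -> ~ contains H G'.
Proof.
move=> [phi [psi phiK psiK] Ephi] HG [f f_inj Ef]; apply: HG.
exists (psi \o f); first exact: inj_comp (can_inj psiK) f_inj.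
move=> e /Ef; rewrite -Ephi -imset_comp.
by rewrite (eq_imset e (g := f)) // => x /=; rewrite psiK.
Qed.

Definition hfree (k : nat) (U : finType) (H : hypergraph k U) : hproperty k :=
  HProperty (@not_contains_iso k U H).

Definition hfamily (k : nat) : Type := forall n : nat, hypergraph k 'I_n -> Prop.

Section SemiAlgebraic.
Variables (R : realType) (k d : nat).

(* A polynomial in k * d variables is a function of k points of R^d, given as
   the rows of Q. *)
Definition eval_points (f : {mpoly R[k * d]}) (Q : 'M[R]_(k, d)) : R :=
  f.@[fun m => mxvec Q 0 m].

(* The d-variate polynomial f(q_1, .., x, .., q_(k-1)) with x in position a:
   the fixed points are the rows of Q other than row a, which is ignored. *)
Definition restrict_points (f : {mpoly R[k * d]}) (a : 'I_k)
    (Q : 'M[R]_(k, d)) : {mpoly R[d]} :=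
  let X := \matrix_(b < k, l < d) (if b == a then 'X_l else (Q b l)%:MP_[d]) in
  f \mPo [tuple mxvec X 0 m | m < k * d].

(* The size of a multivariate polynomial is its total degree plus 1 (0 for the
   zero polynomial). *)
Definition semialgebraic (t D : nat) : hfamily k := fun n G =>
  exists (p : 'I_n -> 'rV[R]_d) (f : 'I_t -> {mpoly R[k * d]})
         (Phi : {ffun 'I_t -> bool} -> bool),
  [/\ injective p,
      forall i : k.-tuple 'I_n, {homo tnth i : a b / (a < b)%N} ->
        adjacent G i <->
        forall s : 'S_k,
          Phi [ffun j => 0 <= eval_points (f j)
                                (\matrix_(a < k) p (tnth i (s a)))]
    & forall (j : 'I_t) (a : 'I_k) (Q : 'M[R]_(k, d)),
        (msize (restrict_points (f j) a Q) <= D.+1)%N].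

End SemiAlgebraic.

(* A randomized adaptive query algorithm on hypergraphs with vertex set 'I_n;
   output true means that the property holds. Draw m makes a uniformly random
   choice among m.+1 alternatives. *)
Inductive algorithm (k n : nat) : Type :=
| Output of bool
| Query of k.-tuple 'I_n & (bool -> algorithm k n)
| Draw (m : nat) of ('I_m.+1 -> algorithm k n).

Fixpoint prob_output (R : realType) (k n : nat) (G : hypergraph k 'I_n)
    (b : bool) (A : algorithm k n) : R :=
  match A with
  | Output c => (c == b)%:R
  | Query u next => prob_output R G b (next (adjacent G u))
  | Draw m next => (\sum_(i < m.+1) prob_output R G b (next i)) / m.+1%:R
  end.

(* Worst case over the answers to the queries and the random choices. *)
Fixpoint query_complexity (k n : nat) (A : algorithm k n) : nat :=
  match A with
  | Output _ => 0
  | Query _ next => (\max_(b : bool) query_complexity (next b)).+1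
  | Draw m next => \max_(i < m.+1) query_complexity (next i)
  end.

Section Testing.
Variables (R : realType) (k : nat).

(* Fraction of the k-subsets of V whose adjacency differs in G and G'; when
   #|V| < k there are none, and the fraction is 0 / 0 = 0. *)
Definition distance (V : finType) (G G' : hypergraph k V) : R :=
  #|(edges G :\: edges G') :|: (edges G' :\: edges G)|%:R / 'C(#|V|, k)%:R.

Definition far (eps : R) (P : hproperty k) (V : finType)
    (G : hypergraph k V) : Prop :=
  forall G' : hypergraph k V, P V G' -> eps <= distance G G'.

Definition tester (eps : R) (P : hproperty k) (F : hfamily k)
    (A : forall n, algorithm k n) : Prop :=
  forall (n : nat) (G : hypergraph k 'I_n), F n G ->
    (P _ G -> 2 / 3 <= prob_output R G true (A n)) /\
    (far eps P G -> 2 / 3 <= prob_output R G false (A n)).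

Definition one_sided (P : hproperty k) (F : hfamily k)
    (A : forall n, algorithm k n) : Prop :=
  forall (n : nat) (G : hypergraph k 'I_n), F n G ->
    P _ G -> prob_output R G true (A n) = 1.

Definition easily_testable (P : hproperty k) (F : hfamily k) : Prop :=
  exists q : {poly R}, forall eps : R, 0 < eps ->
    exists A : forall n, algorithm k n,
      [/\ tester eps P F A, one_sided P F A
        & forall n, (query_complexity (A n))%:R <= q.[eps^-1]].

End Testing.

(* Main.v *)
Require Import Defs.
From mathcomp Require Import all_boot all_order all_algebra.
From mathcomp Require Import perm reals mpoly.
From mathcomp Require Import zify ring lra.

Set Implicit Arguments.
Unset Strict Implicit.
Unset Printing Implicit Defensive.

Import Order.TTheory GRing.Theory Num.Theory.

(** Let n be the number of vertices and h the number of vertices of H. The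
    tester repeats the following round: draw a uniformly random map from the
    vertices of H to the n vertices, query the images of the edges of H, and
    reject if the map is an embedding of H. It never rejects an H-free
    hypergraph, so everything rests on a removal lemma with polynomial bounds:
    if a semi-algebraic G is eps-far from being H-free, then at least an
    eps^O(1) fraction of all maps are embeddings (removal).

    Semi-algebraicity enters only through a bound on traces. Fix all but one
    of the k points: each defining polynomial becomes a polynomial of degree at
    most D in the remaining point, that is, a linear functional of its vector
    of monomials. Linear functionals in M variables cannot realize all sign
    patterns on more than M tests (trace_bounded_halfspace), so by the
    Sauer-Shelah lemma m tests distinguish only polynomially many vertices
    (semialgebraic_growth). Since random tests separate vertices whose links
    differ substantially, only polynomially many vertices can have pairwise
    substantially different links (packing). A maximal such set of vertices
    yields a partition of the vertices into K = poly(1/eps) cells such that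
    vertices in the same cell have almost the same link (exists_clustering).

    Replace the entries of a random k-tuple, one at a time, by random vertices
    of the same cells. Each intermediate tuple is uniform, so each replacement
    rarely changes adjacency, and neither does resampling the whole tuple
    (resample_change_le). Hence few edges lie in boxes of cells that are not
    almost complete; few edges meet cells of fewer than n / b vertices, because
    there are only K cells. Deleting both kinds of edges changes G by
    less than eps, so the result contains a copy of H. All edges of this copy
    lie in almost complete boxes of large cells. Move each vertex of the copy
    to a random vertex of its cell: by the union bound the result maps all
    edges of H to edges of G with probability at least 1/2
    (card_homs_ge), and large cells provide many such maps, at least half of them
    injective when n is large (card_homs_le). When n is at most polynomial in
    1/eps, a single embedding is already a polynomial fraction of all maps.

    An L1 approximation of G by boxes of cells suffices here, which is why no
    geometric cell decomposition of R^d is used. *)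

(** * Powers and shattered families *)

Lemma leq_expn2r m n e : m <= n -> m ^ e <= n ^ e.
Proof. by case: e => // e le_mn; rewrite leq_exp2r. Qed.

(** Bernoulli's inequality gives (1 + 1 / a) ^ (a + 1) >= 2. This turns both
    geometric decays used below, that of unseparated pairs of vertices and that
    of the probability of missing every copy, into powers of 2. *)
Lemma two_expn_le a l : 2 ^ l * a ^ (a.+1 * l) <= a.+1 ^ (a.+1 * l).
Proof.
have bernoulli m : a ^ m.+1 + m.+1 * a ^ m <= a.+1 ^ m.+1.
  elim: m => [|m IHm]; first by rewrite !expn1 expn0; lia.
  rewrite [leqRHS]expnS (leq_trans _ (leq_mul (leqnn _) IHm)) //.
  by rewrite (expnS a m.+1) (expnS a m); nia.
rewrite !expnM -expnMn leq_expn2r // (leq_trans _ (bernoulli a)) // expnS; lia.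
Qed.

Section Shattering.
Variable T : finType.
Implicit Types (F : {set {set T}}) (S A B : {set T}).

Definition shatters F S :=
  [forall A : {set T}, (A \subset S) ==> [exists B in F, B :&: S == A]].

Lemma shattersP F S :
  reflect (forall A, A \subset S -> exists2 B, B \in F & B :&: S = A)
          (shatters F S).
Proof.
apply: (iffP forallP) => [sh A sAS | sh A]; last first.
  by apply/implyP=> /sh[B FB <-]; apply/exists_inP; exists B.
by have /implyP/(_ sAS)/exists_inP[B FB /eqP] := sh A; exists B.
Qed.

Lemma shatters_sub F F' S : F \subset F' -> shatters F S -> shatters F' S.
Proof.
move=> /subsetP sFF' /shattersP sh; apply/shattersP=> A /sh[B /sFF' F'B <-].
by exists B.
Qed.

(** Pajor's strengthening of the Sauer-Shelah lemma, which has the shorter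
    induction: split F by membership of a point x on which it is not constant. A
    set shattered by only one part is shattered by F; if both parts shatter S,
    then F shatters both S and x |: S, and the latter contains x, unlike all the
    sets shattered by either part. So the two counts add up. *)
Lemma card_shattered F : #|F| <= #|[set S | shatters F S]|.
Proof.
have [m] := ubnP #|F|; elim: m F => // m IHm F leFm.
(* A family with at most one member shatters at most the empty set. *)
have [F_le1 | /card_gt1P[A [B [FA FB neqAB]]]] := leqP #|F| 1.
  have [->|/set0Pn[B FB]] := eqVneq F set0; first by rewrite cards0.
  apply: leq_trans F_le1 _; apply/card_gt0P; exists set0; rewrite inE.
  by apply/shattersP=> A; rewrite subset0 => /eqP->; exists B; rewrite ?setI0.
have [x xAB] : exists x, (x \in A) != (x \in B).
  apply/existsP; apply: contraR neqAB; rewrite negb_exists => /forallP eqAB.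
  by apply/eqP/setP=> x; apply/eqP; rewrite -[_ == _]negbK eqAB.
pose F1 := [set C in F | x \in C]; pose F0 := [set C in F | x \notin C].
have cardF : #|F| = #|F0| + #|F1|.
  rewrite addnC -(cardsID [set C : {set T} | x \in C] F).
  by congr (_ + _); apply: eq_card => C; rewrite !inE // andbC.
have [F0_gt0 F1_gt0] : 0 < #|F0| /\ 0 < #|F1|.
  by split; apply/card_gt0P; case: (boolP (x \in A)) xAB => xA;
     case: (boolP (x \in B)) => xB // _; (exists A + exists B); rewrite inE ?FA ?FB ?xA ?xB.
set sh0 := [set S | shatters F0 S]; set sh1 := [set S | shatters F1 S].
have x_free S b : shatters [set C in F | (x \in C) == b] S -> x \notin S.
  move=> /shattersP sh; apply/negP => xS.
  have [|C + eqC] := sh (if b then S :\ x else S).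
    by case: ifP; rewrite ?subD1set.
  rewrite inE => /andP[_ /eqP xC]; move/setP/(_ x): eqC.
  by rewrite inE xC xS; case: (b); rewrite /= ?in_setD1 ?eqxx ?xS.
have x_free0 S : S \in sh0 -> x \notin S.
  rewrite inE => sh; apply: (x_free S false); apply: shatters_sub sh.
  by apply/subsetP=> C; rewrite !inE => /andP[-> /negPf->].
have x_free1 S : S \in sh1 -> x \notin S.
  rewrite inE => sh; apply: (x_free S true); apply: shatters_sub sh.
  by apply/subsetP=> C; rewrite !inE => /andP[-> ->].
pose both := [set x |: S | S in sh0 :&: sh1].
have card_both : #|both| = #|sh0 :&: sh1|.
  apply: card_in_imset => S S'; rewrite !(inE, in_setI) -!(in_set (shatters _)).
  move=> /andP[/x_free0 xS _] /andP[/x_free0 xS' _] eqSS'.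
  by rewrite -(setU1K xS) -(setU1K xS') eqSS'.
have disj : [disjoint sh0 :|: sh1 & both].
  apply/pred0P=> S /=; apply/negbTE/andP=> -[S01 /imsetP[S' _ defS]].
  have: x \in S by rewrite defS setU11.
  by case/setUP: S01 => [/x_free0|/x_free1] /negPf->.
suff le_F : #|F| <= #|sh0 :|: sh1 :|: both|.
  apply: leq_trans le_F _; apply/subset_leq_card/subsetP=> S.
  rewrite -setUA => /setUP[|/setUP[|/imsetP[S' S'01 ->]]]; rewrite ?inE.
  - by apply: shatters_sub; apply/subsetP=> C; rewrite inE => /andP[].
  - by apply: shatters_sub; apply/subsetP=> C; rewrite inE => /andP[].
  have [S'0 S'1] := setIP S'01; have xS' := x_free0 _ S'0.
  move: S'0 S'1; rewrite !inE => /shattersP sh0' /shattersP sh1'.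
  apply/shattersP=> C sC.
  have sCx : C :\ x \subset S' by rewrite subDset setUC -setUC.
  have [xC|xC] := boolP (x \in C).
    have [D] := sh1' _ sCx; rewrite inE => /andP[FD xD] eqD; exists D => //.
    by rewrite setIUr eqD (setIidPr _) ?sub1set // setD1K.
  have [D] := sh0' _ sCx; rewrite inE => /andP[FD xD] eqD; exists D => //.
  rewrite setIUr eqD (_ : D :&: [set x] = set0) ?set0U.
    by apply/setDidPl; rewrite disjoint_sym disjoints1.
  by apply/setP=> y; rewrite !inE; case: eqP => [->|]; rewrite ?(negPf xD) ?andbF.
rewrite cardsU (disjoint_setI0 disj) cards0 subn0 card_both cardsUI cardF //.
by apply: leq_add; apply: IHm; move: leFm F0_gt0 F1_gt0; rewrite cardF; lia.
Qed.

(** Every set with at most N elements is the range of an N-tuple of elements of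
    [option T], the value [None] being used as padding. *)
Lemma card_small_sets N : #|[set S : {set T} | #|S| <= N]| <= #|T|.+1 ^ N.
Proof.
rewrite -card_option -[N in _ ^ N]card_ord -card_ffun.
pose range (f : {ffun 'I_N -> option T}) := [set x | Some x \in codom f].
apply: leq_trans (leq_imset_card range predT); apply/subset_leq_card/subsetP.
move=> S; rewrite inE => leSN; apply/imsetP.
exists [ffun i : 'I_N => nth None [seq Some x | x <- enum S] i] => //.
apply/setP=> x; rewrite inE; apply/idP/codomP => [Sx | [i]]; last first.
  rewrite ffunE; case: (ltnP i (size [seq Some x | x <- enum S])) => [lti|gei].
    by move=> eqx; have := mem_nth None lti; rewrite -eqx mem_map ?mem_enum // => ? ? [].
  by rewrite nth_default.
have ltxN : index x (enum S) < N.
  by apply: leq_trans leSN; rewrite cardE index_mem mem_enum.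
exists (Ordinal ltxN); rewrite ffunE (nth_map x) ?nth_index ?mem_enum //.
by rewrite index_mem mem_enum.
Qed.

Lemma sauer_shelah N F :
  (forall S, shatters F S -> #|S| <= N) -> #|F| <= #|T|.+1 ^ N.
Proof.
move=> small; apply: leq_trans (card_shattered F) _.
apply: leq_trans (card_small_sets N).
by apply/subset_leq_card/subsetP=> S; rewrite !inE; apply: small.
Qed.

End Shattering.

(** * Packing and traces *)

Section Packing.
Variables V W : finType.
Implicit Types (E : V -> W -> bool) (S : {set V}).

Definition discrepancy E u v := #|[set y | E u y != E v y]|.

Lemma discrepancy_triangle E u v w :
  discrepancy E u w <= discrepancy E u v + discrepancy E v w.
Proof.
apply: leq_trans (leq_card_setU _ _); apply/subset_leq_card/subsetP=> y.
by rewrite !inE; do 3!case: (E _ y).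
Qed.

Definition separates E (ys : seq W) S :=
  forall u v, u \in S -> v \in S -> u != v -> has (fun y => E u y != E v y) ys.

(** Formulated through separated sets rather than through traces, because
    separated sets of vertices are what the packing argument produces. *)
Definition growth_bounded E c :=
  forall (ys : seq W) S, separates E ys S -> #|S| <= (size ys).+1 ^ c.

(** Averaging over the tests: each pair of P is separated by a fraction
    1 / a.+1 of all tests, so some test separates this fraction of the pairs that
    are still unseparated. Iterate m times. *)
Lemma exists_separating_tests E a (P : {set V * V}) m : 0 < #|W| ->
    {in P, forall z, #|W| <= a.+1 * discrepancy E z.1 z.2} ->
  exists2 ys : seq W, size ys = m &
    a.+1 ^ m * #|[set z in P | all (fun y => E z.1 y == E z.2 y) ys]|
      <= a ^ m * #|P|.
Proof.
move=> W_gt0 P_far; elim: m => [|m [ys sz_ys IHm]].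
  exists [::]; rewrite // !expn0 !mul1n; apply/subset_leq_card/subsetP=> z.
  by rewrite inE => /andP[].
set Q := [set z in P | _] in IHm.
suff /existsP[y le_y] :
    [exists y, a.+1 * #|[set z in Q | E z.1 y == E z.2 y]| <= a * #|Q|].
  exists (y :: ys); rewrite /= ?sz_ys // !expnS.
  have -> : [set z in P | (E z.1 y == E z.2 y) &&
              all (fun y => E z.1 y == E z.2 y) ys]
            = [set z in Q | E z.1 y == E z.2 y].
    by apply/setP=> z; rewrite !inE -andbA; congr (_ && _); rewrite andbC.
  rewrite mulnAC mulnC; apply: leq_trans (leq_mul (leqnn _) le_y) _.
  by rewrite mulnCA -mulnA leq_mul.
apply: contraT; rewrite negb_exists => /forallP big_y.
have: \sum_(y : W) (a * #|Q|).+1 <= \sum_y a.+1 * #|[set z in Q | E z.1 y == E z.2 y]|.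
  by apply: leq_sum => y _; rewrite ltnNge big_y.
rewrite sum_nat_const -big_distrr /= leqNgt => /negP; case.
have -> : \sum_y #|[set z in Q | E z.1 y == E z.2 y]|
    = \sum_(z in Q) #|[set y | E z.1 y == E z.2 y]|.
  under eq_bigr => y _ do rewrite -sum1_card.
  rewrite (exchange_big_dep (mem Q)) /= => [|y z _]; last by rewrite inE => /andP[].
  apply: eq_bigr => z Qz; rewrite -sum1_card; apply: eq_bigl => y.
  by rewrite [LHS]inE [RHS]inE Qz.
rewrite big_distrr /=; apply: (@leq_ltn_trans (\sum_(z in Q) a * #|W|)).
  apply: leq_sum => z; rewrite inE => /andP[/P_far far_z _].
  have := cardsC [set y | E z.1 y == E z.2 y].
  rewrite (_ : ~: _ = [set y | E z.1 y != E z.2 y]); last by apply/setP=> y; rewrite !inE.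
  by move: far_z; rewrite /discrepancy; nia.
rewrite sum_nat_const mulnS.
have -> : #|Q| * (a * #|W|) = #|W| * (a * #|Q|) by ring.
by rewrite -[ltnLHS]add0n ltn_add2r.
Qed.

(** With r = 4 c + 2 and y = a.+1 * r, this is the growth bound for y ^ 2
    tests. After that many tests a pair survives with probability at most
    2 ^ - (y r), which beats the square of this bound. *)
Definition packing_bound c a := ((a.+1 * (4 * c + 2)) ^ 2).+1 ^ c.

(** If S had one element too many, then the number of tests in the definition
    of the bound would suffice to separate all its pairs, contradicting the
    growth hypothesis. *)
Lemma packing E c a S : growth_bounded E c ->
    {in S &, forall u v, u != v -> #|W| < a.+1 * discrepancy E u v} ->
  #|S| <= packing_bound c a.
Proof.
move=> growE farS; rewrite leqNgt; apply/negP => ltKS.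
set K := packing_bound c a in ltKS; set r := 4 * c + 2.
(* Exactly K.+1 elements, so that the number of pairs is controlled by K. *)
pose S' := [set x in take K.+1 (enum S)].
have sS' : {subset S' <= S}.
  by move=> x; rewrite inE => /mem_take; rewrite mem_enum.
have cS' : #|S'| = K.+1.
  rewrite cardsE (card_uniqP _) ?take_uniq ?enum_uniq // size_takel //.
  by rewrite -cardE.
have K_gt0 : 0 < K by rewrite expn_gt0.
have W_gt0 : 0 < #|W|.
  have /card_gt1P[u [v [Su Sv neq_uv]]] : 1 < #|S| by apply: leq_ltn_trans ltKS.
  have := farS u v Su Sv neq_uv; rewrite /discrepancy.
  have := max_card [set y | E u y != E v y]; case: #|W| => // /[!leqn0] /eqP->.
  by rewrite muln0.
pose P := [set z | [&& z.1 \in S', z.2 \in S' & z.1 != z.2]].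
have [z|ys sz_ys] :=
    exists_separating_tests (E := E) (a := a) (P := P) ((a.+1 * r) ^ 2) W_gt0.
  by rewrite inE => /and3P[/sS' Sz1 /sS' Sz2 neq_z]; apply/ltnW/farS.
set Q := [set z in P | _] => leQ.
have leP : #|P| <= K.+1 ^ 2.
  rewrite -cS' -mulnn -cardsX; apply/subset_leq_card/subsetP=> -[u v].
  by rewrite !inE => /and3P[-> ->].
have ltpow : a ^ ((a.+1 * r) ^ 2) * K.+1 ^ 2 < a.+1 ^ ((a.+1 * r) ^ 2).
  have -> : (a.+1 * r) ^ 2 = a.+1 * (a.+1 * r ^ 2) by rewrite expnMn; ring.
  set y := a.+1 * r; have ge2y : 2 <= y by rewrite /y /r; nia.
  have -> : a.+1 * r ^ 2 = y * r by rewrite /y; ring.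
  have leK : K <= y.+1 ^ (2 * c).
    rewrite /K /packing_bound -/r -/y expnM leq_expn2r //.
    by rewrite -!mulnn; nia.
  have lt2y : y.+1 ^ r <= 2 ^ (y * r) by rewrite expnM leq_expn2r // ltn_expl.
  have e : y.+1 ^ r = (y.+1 ^ (2 * c)) ^ 2 * y.+1 ^ 2.
    by rewrite -expnM -expnD; congr (_ ^ _); rewrite /r; ring.
  rewrite e in lt2y.
  have ltK : K.+1 ^ 2 < 2 ^ (y * r).
    apply: leq_trans lt2y; rewrite -!mulnn; move: leK K_gt0 ge2y.
    move: (y.+1 ^ (2 * c)) => z leKz K_gt0 ge2y.
    have ltKz : K.+1 * K.+1 <= (2 * z) * (2 * z) by apply: leq_mul; lia.
    apply: leq_ltn_trans ltKz _.
    rewrite mulnACA mulnC ltn_pmul2l; last by nia.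
    by apply: (@leq_trans (3 * 3)); rewrite ?leq_mul.
  have [->|a_gt0] := posnP a.
    by rewrite exp0n ?mul0n ?expn_gt0 // mul1n muln_gt0 (ltnW ge2y) /r addn2.
  apply: leq_trans (two_expn_le _ _).
  by rewrite mulnC ltn_pmul2r ?expn_gt0 ?a_gt0.
have Q0 : #|Q| = 0.
  have: a.+1 ^ ((a.+1 * r) ^ 2) * #|Q| < a.+1 ^ ((a.+1 * r) ^ 2) * 1.
    rewrite muln1; apply: leq_ltn_trans leQ _; apply: leq_ltn_trans ltpow.
    by rewrite leq_mul.
  by rewrite ltn_pmul2l ?expn_gt0 // => /[!ltnS] /[!leqn0] /eqP.
suff: #|S'| <= K by rewrite cS' ltnn.
rewrite /K /packing_bound -/r -sz_ys; apply: growE => u v S'u S'v neq_uv.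
apply: contra_eqT Q0; rewrite -all_predC => sep; rewrite -lt0n; apply/card_gt0P.
exists (u, v); rewrite inE; apply/andP; split.
  by rewrite inE /= S'u S'v.
by apply: sub_all sep => y /=; rewrite negbK.
Qed.

(** Send each vertex to a nearby element of a maximal set of pairwise far
    vertices; the packing lemma bounds the size of this set. *)
Lemma exists_clustering E c a : growth_bounded E c ->
  exists2 r : V -> V, #|r @: V| <= packing_bound c a &
    forall v, a.+1 * discrepancy E v (r v) <= #|W|.
Proof.
move=> growE; pose far u v := #|W| < a.+1 * discrepancy E u v.
pose sep S := [forall u in S, forall v in S, (u != v) ==> far u v].
have [S /maxsetP[sepS maxS] _] : {S | maxset sep S & set0 \subset S}.
  by apply: maxset_exists; apply/forall_inP=> u; rewrite inE.
have far_sym u v : far u v = far v u.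
  by rewrite /far /discrepancy; under eq_finset do rewrite eq_sym.
have near v : exists2 u, u \in S & ~~ far v u.
  have [Sv|nSv] := boolP (v \in S).
    exists v => //; rewrite /far /discrepancy (_ : [set _ | _] = set0).
      by rewrite cards0 muln0.
    by apply/setP=> y; rewrite !inE eqxx.
  apply/exists_inP; apply: contraR nSv; rewrite negb_exists_in.
  move=> /forall_inP/= farv; rewrite -(maxS (v |: S)) ?setU11 ?subsetUr //.
  apply/forall_inP=> x xvS; apply/forall_inP=> y yvS; apply/implyP=> neq_xy.
  case/setU1P: xvS => [xv|Sx]; case/setU1P: yvS => [yv|Sy].
  - by rewrite xv yv eqxx in neq_xy.
  - by rewrite xv -[far _ _]negbK farv.
  - by rewrite yv far_sym -[far _ _]negbK farv.
  by have /forall_inP/(_ x Sx)/forall_inP/(_ y Sy)/implyP := sepS; apply.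
pose r v := odflt v [pick u in S | ~~ far v u].
have rP v : (r v \in S) && ~~ far v (r v).
  rewrite /r; case: pickP => //= none; have [u Su nfar] := near v.
  by have := none u; rewrite Su nfar.
exists r => [|v]; last by have /andP[_] := rP v; rewrite -leqNgt.
apply: leq_trans (packing (S := S) growE _).
  by apply/subset_leq_card/subsetP=> _ /imsetP[v _ ->]; have /andP[] := rP v.
move=> u v Su Sv neq_uv.
by have /forall_inP/(_ u Su)/forall_inP/(_ v Sv)/implyP/(_ neq_uv) := sepS.
Qed.

End Packing.

Section Traces.
Variables V W : finType.
Implicit Types (E : V -> W -> bool) (S : {set V}).

Definition trace E m (ys : m.-tuple W) u := [set i | E u (tnth ys i)].

Definition trace_bounded E c :=
  forall m (ys : m.-tuple W), #|[set trace E ys u | u : V]| <= m.+1 ^ c.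

Lemma shatters_traceP E m (ys : m.-tuple W) (S A : {set 'I_m}) :
    shatters [set trace E ys u | u : V] S -> A \subset S ->
  exists u, {in S, forall i, E u (tnth ys i) = (i \in A)}.
Proof.
move=> /shattersP sh /sh[B /imsetP[u _ ->] defA].
by exists u => i Si; rewrite -defA !inE Si andbT.
Qed.

(** On a separated set the joint trace of all the [R x] is injective, so the
    set is no larger than the product of the numbers of traces. *)
Lemma growth_of_traces E (X : finType) (R : X -> V -> W -> bool) (c : X -> nat) :
    (forall u v y, (forall x, R x u y = R x v y) -> E u y = E v y) ->
    (forall x, trace_bounded (R x) (c x)) ->
  growth_bounded E (\sum_x c x).
Proof.
move=> detE bR ys S sepS.
pose joint u := [ffun x => trace (R x) (in_tuple ys) u].
have joint_inj : {in S &, injective joint}.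
  move=> u v Su Sv /ffunP eq_uv; apply/eqP/contraT => neq_uv.
  have /hasP[y /(nthP y)[i lti <-]] := sepS u v Su Sv neq_uv; case/negP; apply/eqP/detE.
  move=> x; move: (eq_uv x); rewrite !ffunE => /setP/(_ (Ordinal lti)).
  by rewrite !inE !(tnth_nth y).
rewrite -(card_in_imset joint_inj) expn_sum.
apply: (@leq_trans (\prod_x #|[set trace (R x) (in_tuple ys) u | u : V]|)); last first.
  by apply: leq_prod => x _; apply: bR.
pose F x := mem [set trace (R x) (in_tuple ys) u | u : V].
have -> : \prod_x #|[set trace (R x) (in_tuple ys) u | u : V]| = #|family F|.
  by rewrite card_family foldrE big_map big_enum.
apply/subset_leq_card/subsetP=> _ /imsetP[u _ ->].
by apply/familyP=> x; rewrite ffunE; apply/imsetP; exists u.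
Qed.

(** A pair {i, j} of tests is not shattered: realizing the pattern {i, j} forces
    both tests to compare with the same vertex, and then {j} is out of reach. *)
Lemma trace_bounded_eq (g : W -> V) : trace_bounded (fun u y => u == g y) 1.
Proof.
move=> m ys; rewrite -[m in m.+1]card_ord; apply: sauer_shelah => S sh.
rewrite leqNgt; apply/negP=> /card_gt1P[i [j [Si Sj neq_ij]]].
have [u eq_u] := shatters_traceP sh (subxx S).
have sjS : [set j] \subset S by rewrite sub1set.
have [v eq_v] := shatters_traceP sh sjS.
have := eq_u j Sj; rewrite Sj => /eqP uj; have := eq_u i Si; rewrite Si => /eqP ui.
have := eq_v j Sj; rewrite set11 => /eqP vj.
by have := eq_v i Si; rewrite inE (negPf neq_ij) vj -uj ui eqxx.
Qed.

End Traces.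

Local Open Scope ring_scope.

(** More than #|M| tests satisfy a nontrivial linear relation, in which some
    coefficient can be taken negative. A vertex whose signs agree with the signs
    of the coefficients would give this relation a positive value. *)
Lemma trace_bounded_halfspace (R : realFieldType) (V W M : finType)
    (phi : V -> M -> R) (c : W -> M -> R) :
  trace_bounded (fun u y => 0 <= \sum_mu c y mu * phi u mu) #|M|.
Proof.
move=> m ys; rewrite -[m in m.+1]card_ord; apply: sauer_shelah => S sh.
rewrite leqNgt; apply/negP => ltMS.
pose A := \matrix_(i < #|S|, mu < #|M|) c (tnth ys (enum_val i)) (enum_val mu).
have: kermx A != 0.
  rewrite -mxrank_eq0 mxrank_ker subn_eq0 -ltnNge.
  by apply: leq_ltn_trans ltMS; apply: rank_leq_col.
move=> /rowV0Pn[lam0 /sub_kermxP lam0A lam0_neq0].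
have [lam lamA [i0 lam_lt0]] :
    exists2 lam : 'rV_#|S|, lam *m A = 0 & exists i, lam 0 i < 0.
  have [i lam0i] : exists i, lam0 0 i != 0.
    apply/existsP; apply: contraR lam0_neq0; rewrite negb_exists => /forallP z.
    by apply/eqP/rowP=> i; rewrite mxE; apply/eqP/negbNE/z.
  have [lt0|gt0|eq0] := ltgtP (lam0 0 i) 0; last by rewrite eq0 eqxx in lam0i.
    by exists lam0 => //; exists i.
  by exists (- lam0); [rewrite mulNmx lam0A oppr0 | exists i; rewrite mxE oppr_lt0].
pose B := [set enum_val i | i : 'I_#|S| & 0 <= lam 0 i].
have sBS : B \subset S by apply/subsetP=> _ /imsetP[i _ ->]; apply: enum_valP.
have [u eq_u] := shatters_traceP sh sBS.
have in_B i : (enum_val i \in B) = (0 <= lam 0 i).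
  by rewrite mem_imset ?inE //; apply: enum_val_inj.
pose val (i : 'I_#|S|) := \sum_mu c (tnth ys (enum_val i)) mu * phi u mu.
have val_sign i : (0 <= val i) = (0 <= lam 0 i).
  by rewrite -in_B -eq_u ?enum_valP.
have sum0 : \sum_i lam 0 i * val i = 0.
  transitivity (\sum_(mu < #|M|) (lam *m A) 0 mu * phi u (enum_val mu)); last first.
    by rewrite lamA big1 // => mu _; rewrite mxE mul0r.
  under [RHS]eq_bigr => mu _ do rewrite mxE big_distrl /=.
  rewrite exchange_big /=; apply eq_bigr => i _.
  rewrite /val (reindex _ (onW_bij _ (@enum_val_bij M))) big_distrr /=.
  by apply eq_bigr => mu _; rewrite mxE mulrA.
suff: 0 < \sum_i lam 0 i * val i by rewrite sum0 ltxx.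
rewrite (bigD1 i0) //=; apply: ltr_pwDl.
  by rewrite nmulr_rgt0 // ltNge val_sign -ltNge.
apply: sumr_ge0 => i _; have [ge0|lt0] := leP 0 (lam 0 i).
  by rewrite mulr_ge0 // val_sign.
by rewrite nmulr_rge0 // ltW // ltNge val_sign -ltNge.
Qed.

(** * Slices of semi-algebraic hypergraphs *)

Definition update (I V : finType) (w : {ffun I -> V}) i x : {ffun I -> V} :=
  [ffun j => if j == i then x else w j].

(** The link of x, as a relation to be tested. A test is a position together
    with a full tuple whose entry at this position gets overwritten, so that the
    discrepancy of two vertices adds up the contributions of all positions. *)
Definition slice (I V : finType) (E : {ffun I -> V} -> bool) x
    (y : I * {ffun I -> V}) := E (update y.2 y.1 x).

Section Edges.
Variables (k : nat) (V : finType) (G : hypergraph k V).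

Definition is_edge (w : {ffun 'I_k -> V}) := [set w i | i : 'I_k] \in edges G.

Lemma card_edge e : e \in edges G -> #|e| = k.
Proof. by have /forall_inP G_unif := edges_uniform G; move=> /G_unif/eqP. Qed.

Lemma is_edge_inj (w : {ffun 'I_k -> V}) : is_edge w -> injective w.
Proof.
move=> /card_edge cw i j.
have /imset_injP inj_w: #|[set w i | i : 'I_k]| == #|'I_k| by rewrite cw card_ord.
by apply: inj_w.
Qed.

Lemma adjacent_mktuple (w : {ffun 'I_k -> V}) :
  adjacent G [tuple w i | i < k] = is_edge w.
Proof.
rewrite /adjacent /is_edge.
suff -> : [set x in [tuple w i | i < k]] = [set w i | i : 'I_k] by [].
apply/setP=> x; rewrite inE; apply/tnthP/imsetP => [] [i].
  by rewrite tnth_mktuple => ->; exists i.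
by move=> _ ->; exists i; rewrite tnth_mktuple.
Qed.

Lemma is_edge_perm (w : {ffun 'I_k -> V}) (s : 'S_k) :
  is_edge [ffun i => w (s i)] = is_edge w.
Proof.
suff eq_im : [set [ffun i => w (s i)] i | i : 'I_k] = [set w i | i : 'I_k].
  by rewrite /is_edge eq_im.
apply/setP=> x; apply/imsetP/imsetP => -[i _].
  by rewrite ffunE => ->; exists (s i).
by move=> ->; exists (s^-1%g i); rewrite // ffunE permKV.
Qed.

End Edges.

(** The semi-algebraic condition speaks of increasing tuples only; any other
    injective tuple is reached through its sorting permutation. *)
Lemma exists_sorting_perm k n (w : {ffun 'I_k -> 'I_n}) : injective w ->
  exists s : 'S_k, {homo (fun i => w (s i)) : a b / (a < b)%N}.
Proof.
move=> w_inj.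
have [s def_s] : exists s : 'S_k, sort (fun x y : 'I_n => x <= y)%N [tuple w i | i < k]
    = [tuple tnth [tuple w i | i < k] (s i) | i < k].
  by apply/tuple_permP; rewrite perm_sort.
have ws i : w (s i) = tnth [tuple tnth [tuple w i | i < k] (s i) | i < k] i.
  by rewrite !tnth_mktuple.
exists s => a b lt_ab; rewrite ltn_neqAle; apply/andP; split.
  apply: contraTN lt_ab => /eqP/val_inj/w_inj/perm_inj->; by rewrite ltnn.
rewrite !ws !(tnth_nth (w (s a))) -def_s.
have le_tr : transitive (fun x y : 'I_n => x <= y)%N by move=> x y z; apply: leq_trans.
have le_tot : total (fun x y : 'I_n => x <= y)%N by move=> x y; apply: leq_total.
apply: (sorted_leq_nth le_tr (fun x => leqnn x) (w (s a)) (sort_sorted le_tot _));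
  by rewrite ?inE ?size_sort ?size_tuple // ltnW.
Qed.


Section SemiAlgebraicGrowth.
Variables (R : realType) (k d t D : nat).

(** Only row [a] of the matrix remains free, so the value is that of the
    d-variate restriction, to which the degree bound applies. *)
Lemma eval_points_restrict (f : {mpoly R[k * d]}) (a : 'I_k) (Q Q' : 'M[R]_(k, d)) :
    (forall b, b != a -> row b Q' = row b Q) ->
  eval_points f Q' = (restrict_points f a Q).@[fun l => Q' a l].
Proof.
move=> eqQ; rewrite /eval_points /restrict_points comp_mpoly_meval.
apply: meval_eq => m; rewrite tnth_mktuple.
case/mxvec_indexP: m => b l; rewrite !mxvecE mxE.
have [->|neq_ba] := eqVneq b a; first by rewrite mevalXU.
by rewrite mevalC; have /rowP/(_ l) := eqQ b neq_ba; rewrite !mxE.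
Qed.

(** Veronese embedding: a polynomial of degree at most D is a linear functional
    of the vector of monomials, whose length depends only on d and D. *)
Lemma meval_monomials (g : {mpoly R[d]}) (v : 'I_d -> R) : (msize g <= D.+1)%N ->
  g.@[v] = \sum_(mu : 'X_{1..d < D.+1}) g@_mu * \prod_l v l ^+ mu l.
Proof.
move=> le_g; rewrite {1}(mpolywE le_g) raddf_sum; apply: eq_bigr => mu _ /=.
by rewrite mevalZ mevalX.
Qed.

(** One unit for each comparison of the new vertex with an entry of the tuple,
    and the number of monomials for each polynomial and each ordering. *)
Definition slice_exponent : nat :=
  \sum_(x : 'I_k + 'I_t * 'S_k)
     if x is inl _ then 1%N else #|{: 'X_{1..d < D.+1}}|.

(** The condition quantifies over all permutations of the points, so it is
    invariant under reordering and extends from increasing tuples to all injective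
    ones; the other tuples span too few vertices to be edges. *)
Lemma semialgebraic_edgeP n (G : hypergraph k 'I_n) (p : 'I_n -> 'rV[R]_d)
    (f : 'I_t -> {mpoly R[k * d]}) (Phi : {ffun 'I_t -> bool} -> bool) :
    (forall i : k.-tuple 'I_n, {homo tnth i : a b / (a < b)%N} ->
        adjacent G i <->
        forall s : 'S_k,
          Phi [ffun j => 0 <= eval_points (f j)
                                (\matrix_(a < k) p (tnth i (s a)))]) ->
  forall w, is_edge G w = injectiveb w && [forall s : 'S_k,
    Phi [ffun j => 0 <= eval_points (f j) (\matrix_(a < k) p (w (s a)))]].
Proof.
move=> adjP w; have [inj_w|ninj_w] := boolP (injectiveb w); last first.
  by apply: contraNF ninj_w => /is_edge_inj/injectiveP.
have [s0 homo_s0] := exists_sorting_perm (elimT (injectiveP w) inj_w).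
rewrite -(is_edge_perm G w s0) -adjacent_mktuple /=.
have tnthE a : tnth [tuple [ffun i => w (s0 i)] i | i < k] a = w (s0 a).
  by rewrite tnth_mktuple ffunE.
have homoT : {homo tnth [tuple [ffun i => w (s0 i)] i | i < k] : a b / (a < b)%N}.
  by move=> a b lt_ab; rewrite !tnthE homo_s0.
apply/idP/forallP => [/(adjP _ homoT) Phi_s s | Phi_s].
  (* The sorting permutation is absorbed by the quantifier over s. *)
  have := Phi_s (s * s0^-1)%g; congr (is_true (Phi _)); apply/ffunP=> j; rewrite !ffunE.
  by congr (0 <= eval_points _ _); apply/row_matrixP=> a; rewrite !rowK tnthE permM permKV.
apply/(adjP _ homoT) => s; have := Phi_s (s * s0)%g; congr (is_true (Phi _)).
apply/ffunP=> j; rewrite !ffunE.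
by congr (0 <= eval_points _ _); apply/row_matrixP=> a; rewrite !rowK tnthE permM.
Qed.

(** Whether overwriting position [i] of [w] by [u] gives an edge depends only on
    which entries of [w] equal [u] and on the signs of the polynomials restricted
    to the moving point. Under the ordering [s] this point is in position
    [s^-1 i]. *)
Lemma semialgebraic_growth n (G : hypergraph k 'I_n) :
  @semialgebraic R k d t D n G -> growth_bounded (slice (is_edge G)) slice_exponent.
Proof.
case=> p [f [Phi [_ adjP deg_f]]].
pose Q (y : 'I_k * {ffun 'I_k -> 'I_n}) (s : 'S_k) := \matrix_(a < k) p (y.2 (s a)).
pose coeffs (js : 'I_t * 'S_k) (y : 'I_k * {ffun 'I_k -> 'I_n}) mu :=
  (restrict_points (f js.1) (js.2^-1%g y.1) (Q y js.2))@_mu.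
pose monos u (mu : 'X_{1..d < D.+1}) := \prod_l p u 0 l ^+ mu l.
pose test (x : 'I_k + 'I_t * 'S_k) u (y : 'I_k * {ffun 'I_k -> 'I_n}) :=
  match x with
  | inl l => u == y.2 l
  | inr js => 0 <= \sum_(mu : 'X_{1..d < D.+1}) coeffs js y mu * monos u mu
  end.
apply: (growth_of_traces (R := test)); last first.
  case=> [l|js] /=; first exact:
    (trace_bounded_eq (fun y : 'I_k * {ffun 'I_k -> 'I_n} => y.2 l)).
  exact: (trace_bounded_halfspace monos (coeffs js)).
have edgeE := @semialgebraic_edgeP n G p f Phi adjP.
move=> u v [i w] eq_uv; rewrite /slice /= !edgeE.
have signE x (s : 'S_k) j :
    (0 <= eval_points (f j) (\matrix_(a < k) p (update w i x (s a))))
    = test (inr (j, s)) x (i, w).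
  rewrite /= (@eval_points_restrict _ (s^-1%g i) (Q (i, w) s)) => [|b neq_b].
    rewrite (meval_monomials _ (deg_f _ _ _)); congr (0 <= _); apply: eq_bigr => mu _.
    by congr (_ * _); apply: eq_bigr => l _; rewrite mxE ffunE permKV eqxx.
  rewrite !rowK ffunE; case: eqP => // eq_i; case/eqP: neq_b.
  by rewrite -eq_i permK.
congr (_ && _); last first.
  apply: eq_forallb => s; congr (Phi _); apply/ffunP => j; rewrite !ffunE.
  by rewrite !signE eq_uv.
suff imp x x' : (forall l, (x == w l) = (x' == w l)) ->
    injectiveb (update w i x) -> injectiveb (update w i x').
  by apply/idP/idP; apply: imp => l; have /= := eq_uv (inl l).
move=> eqx /injectiveP inj_x; apply/injectiveP => a b.
have := inj_x a b; rewrite !ffunE.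
case: eqP => [->|_]; case: eqP => [->|_] //.
  by move=> inj /eqP; rewrite -eqx => /eqP.
by move=> inj /esym/eqP; rewrite -eqx => /eqP/esym.
Qed.

End SemiAlgebraicGrowth.

(** * Resampling inside cells *)

Section ProductMeasures.
Variables (R : realFieldType) (I V : finType).

(** The map sending (w, x) to (update w i x, w i) is an involution. *)
Lemma sum_update (F : {ffun I -> V} -> R) i :
  \sum_w \sum_x F (update w i x) = #|V|%:R * \sum_w F w.
Proof.
pose swap (z : {ffun I -> V} * V) := (update z.1 i z.2, z.1 i).
have swapK : involutive swap.
  case=> w x; rewrite /swap /= ffunE eqxx; congr (_, _); apply/ffunP=> j.
  by rewrite !ffunE; case: eqP => // ->.
rewrite pair_bigA /= (reindex_inj (inv_inj swapK)) /=.
rewrite (eq_bigr (fun z => F z.1)) => [|[w x] _]; last first.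
  by congr F; exact: (congr1 (fun z => z.1) (swapK (w, x))).
rewrite -(pair_bigA _ (fun w (x : V) => F w)) /= mulr_sumr.
by apply: eq_bigr => w _; rewrite sumr_const mulr_natl.
Qed.

(** Under a product measure the coordinates outside the image of [t] integrate
    to 1, and those inside it remain independent. *)
Lemma sum_prod_marginal (J : finType) (t : J -> I) (lam : I -> V -> R)
    (F : {ffun J -> V} -> R) :
    injective t -> (forall i, \sum_x lam i x = 1) ->
  \sum_(w : {ffun I -> V}) (\prod_i lam i (w i)) * F [ffun j => w (t j)]
    = \sum_(v : {ffun J -> V}) (\prod_j lam (t j) (v j)) * F v.
Proof.
move=> t_inj lam1.
transitivity (\sum_(w : {ffun I -> V}) \sum_(v : {ffun J -> V})
    ([ffun j => w (t j)] == v)%:R * ((\prod_i lam i (w i)) * F v)).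
  apply: eq_bigr => w _; rewrite (bigD1 [ffun j => w (t j)]) //= eqxx mul1r.
  rewrite [X in _ + X]big1 ?addr0 // => v neq_v.
  by rewrite eq_sym (negPf neq_v) mul0r.
rewrite exchange_big /=; apply: eq_bigr => v _.
under eq_bigr => w _ do rewrite mulrA; rewrite -mulr_suml; congr (_ * _).
(* The condition that w extends v along t is a product of conditions on the
   coordinates, so the sum over w factors. *)
pose agrees i x := [forall j, (t j == i) ==> (x == v j)].
transitivity (\sum_(w : {ffun I -> V}) \prod_i ((agrees i (w i))%:R * lam i (w i))).
  apply: eq_bigr => w _; rewrite big_split /=; congr (_ * _).
  have [eq_wv|neq_wv] := eqVneq; first last.
    have [j neq_j] : exists j, w (t j) != v j.
      apply/existsP; apply: contraR neq_wv; rewrite negb_exists => /forallP eqj.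
      by apply/eqP/ffunP=> j; rewrite ffunE; apply/eqP/negbNE/eqj.
    rewrite (bigD1 (t j)) //= (_ : agrees _ _ = false) ?mul0r //.
    apply/negbTE; rewrite negb_forall; apply/existsP; exists j.
    by rewrite eqxx neq_j.
  rewrite big1 // => i _; rewrite (_ : agrees _ _ = true) //.
  by apply/forallP=> j; apply/implyP => /eqP<-; rewrite -eq_wv ffunE.
rewrite -(bigA_distr_bigA (fun i x => (agrees i x)%:R * lam i x)).
rewrite (bigID (fun i => i \in codom t)) /= [X in _ * X]big1 ?mulr1; last first.
  move=> i nti; rewrite -[RHS](lam1 i); apply: eq_bigr => x _.
  rewrite (_ : agrees i x = true) ?mul1r //; apply/forallP=> j.
  by apply/implyP=> /eqP ti; case/negP: nti; rewrite -ti codom_f.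
rewrite -big_uniq ?(map_inj_uniq t_inj) ?enum_uniq //= big_map big_enum /=.
apply: eq_bigr => j _; rewrite (bigD1 (v j)) //= big1 ?addr0.
  rewrite (_ : agrees _ _ = true) ?mul1r //.
  by apply/forallP=> j'; apply/implyP=> /eqP/t_inj->.
move=> x neq_x; rewrite (_ : agrees _ _ = false) ?mul0r //.
apply/negbTE; rewrite negb_forall; apply/existsP; exists j.
by rewrite eqxx.
Qed.

Lemma sum_prod_marginal1 (lam : I -> V -> R) i (F : V -> R) :
    (forall j, \sum_x lam j x = 1) ->
  \sum_(w : {ffun I -> V}) (\prod_j lam j (w j)) * F (w i)
    = \sum_x lam i x * F x.
Proof.
move=> lam1.
transitivity (\sum_(w : {ffun I -> V}) \prod_j (lam j (w j) * if j == i then F (w j) else 1)).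
  apply: eq_bigr => w _; rewrite big_split /=; congr (_ * _).
  by rewrite (bigD1 i) //= eqxx big1 ?mulr1 // => j /negPf->.
rewrite -(bigA_distr_bigA (fun j x => lam j x * if j == i then F x else 1)).
rewrite (bigD1 i) //= eqxx [X in _ * X]big1 ?mulr1 // => j /negPf->.
by rewrite -[RHS](lam1 j); apply: eq_bigr => x _; rewrite mulr1.
Qed.

End ProductMeasures.

Section Resampling.
Variables (R : realFieldType) (V T : finType) (cl : V -> T).

Definition cell x := [set y | cl y == cl x].

(** The Markov kernel that moves x to a uniformly random vertex of its cell. It
    is symmetric, so it preserves the uniform distribution. *)
Definition resample x y : R := (y \in cell x)%:R / #|cell x|%:R.

Lemma card_cell_gt0 x : (0 < #|cell x|)%N.
Proof. by apply/card_gt0P; exists x; rewrite inE. Qed.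

Lemma resample_ge0 x y : 0 <= resample x y.
Proof. by rewrite divr_ge0. Qed.

Lemma resample_sym x y : resample x y = resample y x.
Proof.
rewrite /resample !inE eq_sym; have [eq_cl|] := eqVneq; last by rewrite !mul0r.
by rewrite /cell eq_cl.
Qed.

Lemma sum_uniform (B : {set V}) : (0 < #|B|)%N ->
  \sum_x (x \in B)%:R / #|B|%:R = 1 :> R.
Proof.
move=> B_gt0; rewrite -mulr_suml -natr_sum -big_mkcond sum1_card divff //.
by rewrite pnatr_eq0 -lt0n.
Qed.

Lemma sum_resample x : \sum_y resample x y = 1.
Proof. exact/sum_uniform/card_cell_gt0. Qed.

Lemma neq_telescope (b : nat -> bool) m :
  (b 0 != b m)%:R <= \sum_(i < m) (b i != b i.+1)%:R :> R.
Proof.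
elim: m => [|m IHm]; first by rewrite eqxx big_ord0.
rewrite big_ord_recr /=; apply: le_trans (lerD IHm (lexx _)).
by rewrite -natrD ler_nat; case: (b 0); case: (b m); case: (b m.+1).
Qed.

Variables (k : nat) (E : {ffun 'I_k -> V} -> bool).

(** Hybrid argument. Replace the entries one by one; adjacency changes overall
    only if it changes at some step. At step i, exchanging the old and new values
    of the entries before i preserves the symmetric weight and turns the hybrid
    back into the original tuple, of which only entry i is replaced. *)
Lemma resample_coordinatewise :
  \sum_(w : {ffun 'I_k -> V}) \sum_(w' : {ffun 'I_k -> V})
      (\prod_i resample (w i) (w' i)) * (E w != E w')%:R
    <= \sum_i \sum_(w : {ffun 'I_k -> V}) \sum_x
      resample (w i) x * (E w != E (update w i x))%:R.
Proof.
rewrite pair_bigA /=.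
pose hyb m (z : {ffun 'I_k -> V} * {ffun 'I_k -> V}) : {ffun 'I_k -> V} :=
  [ffun j : 'I_k => if (j < m)%N then z.2 j else z.1 j].
pose weight (z : {ffun 'I_k -> V} * {ffun 'I_k -> V}) := \prod_i resample (z.1 i) (z.2 i).
apply: (@le_trans _ _ (\sum_z \sum_(i < k) weight z * (E (hyb i z) != E (hyb i.+1 z))%:R)).
  apply: ler_sum => z _; rewrite -mulr_sumr ler_wpM2l //.
    by apply: prodr_ge0 => i _; apply: resample_ge0.
  have hyb0 : hyb 0 z = z.1 by apply/ffunP=> j; rewrite ffunE.
  have hybk : hyb k z = z.2 by apply/ffunP=> j; rewrite ffunE ltn_ord.
  by have := neq_telescope (fun m => E (hyb m z)) k; rewrite hyb0 hybk.
rewrite exchange_big /= le_eqVlt; apply/predU1l/eq_bigr => i _.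
(* Exchange old and new values in the positions before i. *)
pose swap (z : {ffun 'I_k -> V} * {ffun 'I_k -> V}) :=
  (hyb i z, hyb i (z.2, z.1)).
have swapK : involutive swap.
  case=> w w'; rewrite /swap /hyb /=.
  by congr pair; apply/ffunP=> j; rewrite !ffunE; case: (_ < _)%N.
rewrite (reindex_inj (inv_inj swapK)) /=.
transitivity (\sum_z weight z * (E z.1 != E (update z.1 i (z.2 i)))%:R).
  apply: eq_bigr => z _; congr (_ * _).
    apply: eq_bigr => j _; rewrite !ffunE /=; case: ifP => // _.
    exact: resample_sym.
  congr ((E _ != E _)%:R); apply/ffunP=> j; rewrite /swap /hyb !ffunE /=.
    by case: (_ < _)%N.
  rewrite ltnS leq_eqVlt val_eqE; case: eqP => [->|_] /=; first by rewrite ltnn.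
  by case: (_ < _)%N.
rewrite -(pair_bigA _ (fun w w' : {ffun 'I_k -> V} =>
  weight (w, w') * (E w != E (update w i (w' i)))%:R)) /=.
apply: eq_bigr => w _.
apply: (@sum_prod_marginal1 R _ V (fun j => resample (w j)) i
  (fun x => (E w != E (update w i x))%:R)) => j.
exact: sum_resample.
Qed.

(** Refreshing entry i by a uniform vertex first does not change the average
    ([sum_update]); summing over i then produces the discrepancy of two vertices
    of the same cell. *)
Lemma resample_change_le (delta : R) : (0 < #|V|)%N ->
    (forall x y, cl x = cl y -> (discrepancy (slice E) x y)%:R <= delta) ->
  \sum_(w : {ffun 'I_k -> V}) \sum_(w' : {ffun 'I_k -> V})
      (\prod_i resample (w i) (w' i)) * (E w != E w')%:R
    <= delta.
Proof.
move=> V_gt0 disc_le; apply: le_trans resample_coordinatewise _.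
have n_gt0 : 0 < #|V|%:R :> R by rewrite ltr0n.
rewrite -(ler_pM2l n_gt0) mulr_sumr.
have -> : \sum_i #|V|%:R * (\sum_(w : {ffun 'I_k -> V}) \sum_x
      resample (w i) x * (E w != E (update w i x))%:R)
    = \sum_y \sum_x resample y x * (discrepancy (slice E) y x)%:R.
  have discE y x : (discrepancy (slice E) y x)%:R
      = \sum_i \sum_(w : {ffun 'I_k -> V}) (E (update w i y) != E (update w i x))%:R :> R.
    rewrite pair_bigA /discrepancy -sum1_card natr_sum big_mkcond /=.
    by apply: eq_bigr => -[i w] _; rewrite inE; case: ifP.
  under [RHS]eq_bigr => y _ do under eq_bigr => x _ do rewrite discE mulr_sumr.
  under [RHS]eq_bigr => y _ do rewrite exchange_big.
  rewrite [RHS]exchange_big; apply: eq_bigr => i _ /=.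
  under [RHS]eq_bigr => y _ do (under eq_bigr => x _ do rewrite mulr_sumr; rewrite exchange_big).
  rewrite [RHS]exchange_big /=.
  rewrite -(sum_update (fun w => \sum_x resample (w i) x * (E w != E (update w i x))%:R) i).
  apply: eq_bigr => w _; apply: eq_bigr => y _; apply: eq_bigr => x _.
  rewrite ffunE eqxx; congr (_ * (_ != E _)%:R).
  by apply/ffunP=> j; rewrite !ffunE; case: eqP.
rewrite mulr_natl -sumr_const; apply: ler_sum => y _.
have -> : delta = \sum_x resample y x * delta.
  by rewrite -mulr_suml sum_resample mul1r.
apply: ler_sum => x _.
have [|ncl] := boolP (x \in cell y).
  rewrite inE => /eqP/esym cl_yx; rewrite ler_wpM2l ?resample_ge0 //.
  exact: disc_le.
by rewrite /resample (negPf ncl) !mul0r.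
Qed.

End Resampling.

(** * Pruning and counting copies *)

Definition embeddings (k : nat) (U V : finType) (H : hypergraph k U)
    (G : hypergraph k V) :=
  [set f : {ffun U -> V} | injectiveb f &
    [forall e in edges H, f @: e \in edges G]].

Lemma containsP (k : nat) (U V : finType) (H : hypergraph k U) (G : hypergraph k V) :
  contains H G <-> (0 < #|embeddings H G|)%N.
Proof.
split=> [[f f_inj fH] | /card_gt0P[f]].
  apply/card_gt0P; exists [ffun u => f u]; rewrite inE; apply/andP; split.
    by apply/injectiveP => u v; rewrite !ffunE => /f_inj.
  apply/forall_inP=> e /fH; rewrite (eq_imset e (g := f)) // => u.
  by rewrite ffunE.
rewrite inE => /andP[/injectiveP f_inj /forall_inP fH].
by exists f.
Qed.

(** Compare n (k - i) with k (n - i) factor by factor. *)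
Lemma expn_le_bin n k : (k <= n)%N -> (n ^ k <= k ^ k * 'C(n, k))%N.
Proof.
move=> le_kn; rewrite -(leq_pmul2r (fact_gt0 k)) -mulnA bin_ffact.
have powE m : (m ^ k = \prod_(i < k) m)%N by rewrite prod_nat_const card_ord.
rewrite -ffactnn !ffact_prod !powE -!big_split /=; apply: leq_prod => i _.
by have := ltn_ord i; nia.
Qed.

Lemma natr_card (R : pzSemiRingType) (X : finType) (A : {set X}) :
  #|A|%:R = \sum_x (x \in A)%:R :> R.
Proof.
by rewrite -sum1_card natr_sum big_mkcond; apply: eq_bigr => x _; case: ifP.
Qed.

Section RemovalArgument.
Variables (R : realFieldType) (k : nat) (V T : finType) (G : hypergraph k V).
Variables (cl : V -> T) (b g : nat).
Hypothesis V_gt0 : (0 < #|V|)%N.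
Hypothesis b_gt0 : (0 < b)%N.

Local Notation kappa := (resample R cl).

(** The edge density of the box of cells around [w]. *)
Definition density (w : {ffun 'I_k -> V}) : R :=
  \sum_(w' : {ffun 'I_k -> V}) (\prod_i kappa (w i) (w' i)) * (is_edge G w')%:R.

Definition small_cell x := (b * #|cell cl x| < #|V|)%N.

(** The edge tuples to be deleted: those whose box misses more than a
    fraction 1 / g of its tuples, and those meeting a cell with fewer than
    n / b vertices. *)
Definition atypical := [set w | is_edge G w &
  (1 < g%:R * (1 - density w)) || [exists i, small_cell (w i)]].

Lemma sum_prod_resample (w : {ffun 'I_k -> V}) :
  \sum_(w' : {ffun 'I_k -> V}) \prod_i kappa (w i) (w' i) = 1.
Proof.
rewrite -(bigA_distr_bigA (fun i x => kappa (w i) x)) big1 // => i _.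
exact: sum_resample.
Qed.

Lemma one_sub_density w : 1 - density w =
  \sum_(w' : {ffun 'I_k -> V}) (\prod_i kappa (w i) (w' i)) * (~~ is_edge G w')%:R.
Proof.
rewrite -{1}(sum_prod_resample w) /density -sumrB; apply: eq_bigr => w' _.
by case: (is_edge G w'); rewrite /= ?mulr1 ?mulr0 ?subr0 ?subrr.
Qed.

(** Such an edge contributes at least 1 / g to the probability that resampling
    changes adjacency. *)
Lemma card_sparse_le (delta : R) :
    (forall x y, cl x = cl y ->
       (discrepancy (slice (is_edge G)) x y)%:R <= delta) ->
  #|[set w | is_edge G w & 1 < g%:R * (1 - density w)]|%:R <= g%:R * delta.
Proof.
move=> disc_le.
apply: le_trans (_ : _ <= g%:R * \sum_(w : {ffun 'I_k -> V}) \sum_(w' : {ffun 'I_k -> V})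
  (\prod_i kappa (w i) (w' i)) * (is_edge G w != is_edge G w')%:R) _; last first.
  by rewrite ler_wpM2l // resample_change_le.
rewrite -sum1_card natr_sum big_mkcond mulr_sumr; apply: ler_sum => w _ /=.
rewrite inE; case: ifP => [/andP[Ew lt1]|_]; last first.
  by rewrite mulr_ge0 ?sumr_ge0 // => w' _;
     rewrite mulr_ge0 ?prodr_ge0 // => i _; apply: resample_ge0.
apply/ltW/(lt_le_trans lt1); rewrite one_sub_density ler_wpM2l //.
by apply: ler_sum => w' _; rewrite Ew; case: (is_edge G w').
Qed.

(** There are at most K cells, and each small one has fewer than n / b
    vertices. *)
Lemma card_small_cell_le K : (#|cl @: V| <= K)%N ->
  (b * #|[set x | small_cell x]| <= K * #|V|)%N.
Proof.
move=> cl_le; apply: leq_trans (leq_mul cl_le (leqnn _)).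
rewrite -sum1_card (partition_big cl (mem (cl @: V))) /=; last first.
  by move=> x _; apply: imset_f.
rewrite big_distrr /= -sum_nat_const; apply: leq_sum => c _.
have [x|none] := pickP (fun x => (x \in [set x | small_cell x]) && (cl x == c)); last first.
  by rewrite (eq_bigl _ _ none) big_pred0_eq muln0.
rewrite inE => /andP[small_x /eqP cl_x]; apply: leq_trans (ltnW small_x).
rewrite leq_mul2l sum1_card; apply/orP; right; apply/subset_leq_card/subsetP=> y.
by move=> /andP[_ /eqP cl_y]; rewrite inE cl_x cl_y.
Qed.

Lemma card_coordinate_in (I : finType) (i : I) (S : {set V}) :
  (#|V| * #|[set w : {ffun I -> V} | w i \in S]| = #|V| ^ #|I| * #|S|)%N.
Proof.
apply/eqP; rewrite -(eqr_nat rat) !natrM natr_card.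
rewrite -(sum_update (fun w : {ffun I -> V} => (w \in [set w : {ffun I -> V} | w i \in S])%:R) i).
rewrite (eq_bigr (fun _ => #|S|%:R)).
  by rewrite sumr_const card_ffun mulr_natl.
by move=> w _; rewrite natr_card; apply: eq_bigr => x _; rewrite inE ffunE eqxx.
Qed.

Lemma card_atypical_le K (delta : R) : (#|cl @: V| <= K)%N ->
    (forall x y, cl x = cl y ->
       (discrepancy (slice (is_edge G)) x y)%:R <= delta) ->
  #|atypical|%:R <=
  g%:R * delta + (k * K)%:R * (#|V| ^ k)%:R / b%:R.
Proof.
move=> cl_le disc_le; pose smallw := [set w : {ffun 'I_k -> V} | [exists i, small_cell (w i)]].
apply: le_trans (_ : _ <= (#|[set w | is_edge G w & 1 < g%:R * (1 - density w)]|
   + #|smallw|)%:R) _.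
  rewrite ler_nat; apply: leq_trans (leq_card_setU _ _).
  apply/subset_leq_card/subsetP=> w; rewrite !inE => /andP[-> /orP[->|->]] //.
  by rewrite orbT.
rewrite natrD lerD ?card_sparse_le // ler_pdivlMr ?ltr0n // -!natrM ler_nat.
have le_small : (#|smallw| <=
    \sum_(i < k) #|[set w : {ffun 'I_k -> V} | w i \in [set x | small_cell x]]|)%N.
  have -> : smallw = \bigcup_(i < k) [set w : {ffun 'I_k -> V} | w i \in [set x | small_cell x]].
    apply/setP=> w; rewrite inE; apply/existsP/bigcupP=> -[i]; last first.
      by rewrite !inE => _; exists i.
    by exists i; rewrite ?inE.
  apply: (big_ind2 (fun (A : {set {ffun 'I_k -> V}}) m => #|A| <= m)%N) => //.
    by rewrite cards0.
  by move=> A m B n leA leB; apply: leq_trans (leq_card_setU A B) (leq_add leA leB).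
rewrite -(leq_pmul2l V_gt0) mulnA.
apply: leq_trans (leq_mul (leq_mul (leqnn _) le_small) (leqnn _)) _.
rewrite big_distrr /=.
under eq_bigr => i _ do rewrite card_coordinate_in card_ord.
rewrite sum_nat_const card_ord -!mulnA [X in (_ * X <= _)%N]mulnC -mulnA.
have := leq_mul (leqnn (k * #|V| ^ k)%N) (card_small_cell_le cl_le).
by congr (_ <= _)%N; ring.
Qed.


Lemma pruned_uniform :
  [forall e in edges G :\:
      [set [set w i | i : 'I_k] | w : {ffun 'I_k -> V} in atypical],
    #|e| == k].
Proof. by apply/forall_inP=> e /setDP[Ge _]; rewrite (card_edge Ge). Qed.

Definition pruned := Hypergraph pruned_uniform.

Lemma card_pruned_le :
  (#|(edges G :\: edges pruned) :|: (edges pruned :\: edges G)| <= #|atypical|)%N.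
Proof.
apply: leq_trans (leq_imset_card (fun w : {ffun 'I_k -> V} => [set w i | i : 'I_k]) _).
apply/subset_leq_card/subsetP=> e; rewrite !inE.
by case: (e \in edges G); case: (e \in _ @: _).
Qed.

Variables (U : finType) (H : hypergraph k U) (f : U -> V).
Hypothesis f_emb : forall e, e \in edges H -> f @: e \in edges pruned.
Hypothesis g_gt : (#|edges H| * 2 < g)%N.

(** Where a vertex of H may be moved. A vertex of the copy in a small cell lies on
    no surviving edge, hence is unconstrained and may be moved anywhere; so every
    block is large. *)
Definition block u : {set V} := if small_cell (f u) then setT else cell cl (f u).

Definition block_weight u x : R := (x \in block u)%:R / #|block u|%:R.

Lemma block_large u : (#|V| <= b * #|block u|)%N.
Proof.
rewrite /block /small_cell; case: ltnP => // _.
by rewrite cardsT leq_pmull.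
Qed.

Lemma block_gt0 u : (0 < #|block u|)%N.
Proof.
rewrite lt0n; apply: contraTneq (block_large u) => ->.
by rewrite muln0 leqn0 -lt0n.
Qed.

Lemma block_weight_ge0 u x : 0 <= block_weight u x.
Proof. by rewrite divr_ge0. Qed.

Lemma sum_block_weight u : \sum_x block_weight u x = 1.
Proof. exact/sum_uniform/block_gt0. Qed.

Lemma exists_edge_indexing e : e \in edges H ->
  exists2 t : 'I_k -> U, injective t & [set t i | i : 'I_k] = e.
Proof.
move=> He; have ce := card_edge He.
exists (fun i => enum_val (cast_ord (esym ce) i)).
  by move=> i j /enum_val_inj/cast_ord_inj.
apply/setP=> u; apply/imsetP/idP => [[i _ ->]|eu]; first exact: enum_valP.
by exists (cast_ord ce (enum_rank_in eu u)); rewrite // cast_ordK enum_rankK_in.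
Qed.

(** The restriction of the random map to [e] is a resampling of the image of
    [e] under [f], since every cell met by a surviving edge is large; and the box
    of that edge is almost complete. *)
Lemma edge_missed_le e : e \in edges H ->
  g%:R * \sum_(psi : {ffun U -> V}) (\prod_u block_weight u (psi u)) *
    (psi @: e \notin edges G)%:R <= 1.
Proof.
move=> He; have [t t_inj def_e] := exists_edge_indexing He.
have im_t (psi : U -> V) : psi @: e = [set psi (t i) | i : 'I_k].
  by rewrite -def_e -imset_comp.
pose w := [ffun i => f (t i)].
have im_w : f @: e = [set w i | i : 'I_k].
  by rewrite im_t; apply: eq_imset => i; rewrite ffunE.
have [Gw w_typ] : is_edge G w /\ w \notin atypical.
  have /setDP[Gfe ne] := f_emb He; rewrite /is_edge -im_w; split=> //.
  by apply: contra ne => w_atyp; apply/imsetP; exists w.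
move: w_typ; rewrite inE Gw negb_or negb_exists -leNgt => /andP[dens_w /forallP large_w].
apply: le_trans dens_w; rewrite one_sub_density ler_wpM2l //.
rewrite (eq_bigr (fun psi : {ffun U -> V} => (\prod_u block_weight u (psi u)) *
    (~~ is_edge G [ffun j => psi (t j)])%:R)); last first.
  move=> psi _; rewrite im_t /is_edge.
  by rewrite (eq_imset _ (g := [ffun j => psi (t j)])) // => i; rewrite ffunE.
rewrite (sum_prod_marginal (fun v => (~~ is_edge G v)%:R) t_inj sum_block_weight).
rewrite le_eqVlt; apply/predU1l/eq_bigr => v _; congr (_ * _).
apply: eq_bigr => i _; rewrite /block_weight /block /resample.
by have := large_w i; rewrite ffunE => /negPf->.
Qed.

(** Injectivity is not required here: the random choices in the blocks are
    independent and may collide. *)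
Definition homs :=
  [set psi : {ffun U -> V} | [forall e in edges H, psi @: e \in edges G]].

(** By the union bound a random map into the blocks is a homomorphism with
    probability at least 1/2, while each map has probability at most
    (b / n) ^ #|U| because the blocks are large. *)
Lemma card_homs_ge :
  (#|V| ^ #|U| <= 2 * b ^ #|U| * #|homs|)%N.
Proof.
pose nu (psi : {ffun U -> V}) := \prod_u block_weight u (psi u).
have nu_ge0 psi : 0 <= nu psi by apply: prodr_ge0 => u _; apply: block_weight_ge0.
have sum_nu : \sum_psi nu psi = 1.
  rewrite -(bigA_distr_bigA block_weight) big1 // => u _; exact: sum_block_weight.
have g_gt0 : 0 < g%:R :> R by rewrite ltr0n; apply: leq_ltn_trans g_gt.
have half_le : 1 <= 2 * \sum_psi nu psi * (psi \in homs)%:R.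
  have missed : \sum_psi nu psi * (psi \notin homs)%:R <=
      \sum_(e in edges H) \sum_psi nu psi * (psi @: e \notin edges G)%:R.
    rewrite exchange_big /=; apply: ler_sum => psi _; rewrite -mulr_sumr ler_wpM2l //.
    have [|] := boolP (psi \in homs); first by move=> _; apply: sumr_ge0.
    rewrite inE negb_forall_in => /exists_inP[e He ne].
    by rewrite (bigD1 e) //= ne lerDl sumr_ge0.
  have missed2 : g%:R * \sum_psi nu psi * (psi \notin homs)%:R <= #|edges H|%:R.
    apply: le_trans (ler_wpM2l (ltW g_gt0) missed) _.
    rewrite mulr_sumr -sum1_card natr_sum; apply: ler_sum => e He.
    exact: edge_missed_le.
  have split_nu : \sum_psi nu psi * (psi \in homs)%:R + \sum_psi nu psi * (psi \notin homs)%:R = 1.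
    rewrite -big_split -[RHS]sum_nu; apply: eq_bigr => psi _ /=.
    by rewrite -mulrDr; case: (psi \in homs); rewrite /= ?addr0 ?add0r mulr1.
  have lt_g : #|edges H|%:R * 2 < g%:R :> R by rewrite -natrM ltr_nat.
  move: split_nu missed2 lt_g; set X := \sum_psi _; set Y := \sum_psi _; set m := #|edges H|%:R.
  set gg := g%:R; move=> *.
  have : gg * (2 * Y) <= gg * 1 by lra.
  by rewrite ler_pM2l //; lra.
have n_gt0 : 0 < #|V|%:R :> R by rewrite ltr0n.
have nu_le psi : nu psi * (#|V| ^ #|U|)%:R <= (b ^ #|U|)%:R.
  rewrite !natrX -!prodr_const /nu -big_split /=; apply: ler_prod => u _.
  rewrite mulr_ge0 ?block_weight_ge0 //= /block_weight mulrAC ler_pdivrMr ?ltr0n ?block_gt0 //.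
  rewrite -!natrM ler_nat; case: (psi u \in _); rewrite ?mul0n // mul1n.
  exact: block_large.
rewrite -(ler_nat R) -[leLHS]mul1r.
apply: le_trans (ler_wpM2r (ler0n _ _) half_le) _.
rewrite !natrM -!mulrA ler_pM2l ?ltr0n // natr_card mulr_suml mulr_sumr.
by apply: ler_sum => psi _; rewrite mulrAC ler_wpM2r.
Qed.

(** For each pair of distinct vertices of H, the proportion of maps that
    identify them is 1 / n. *)
Lemma card_homs_le :
  (#|V| * #|homs| <= #|V| * #|embeddings H G| + #|U| ^ 2 * #|V| ^ #|U|)%N.
Proof.
pose glued (uv : U * U) := [set psi : {ffun U -> V} | psi uv.1 == psi uv.2].
pose D := [set uv : U * U | uv.1 != uv.2].
have card_glued uv : uv \in D -> (#|V| * #|glued uv| = #|V| ^ #|U|)%N.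
  case: uv => u v; rewrite inE eq_sym => /negPf/= neq_vu.
  apply/eqP; rewrite -(eqr_nat rat) natrM natr_card.
  rewrite -(sum_update (fun psi => (psi \in glued (u, v))%:R) u).
  rewrite (eq_bigr (fun _ => 1)); first by rewrite sumr_const card_ffun.
  move=> psi _; rewrite (bigD1 (psi v)) //= big1 => [|x neq_x].
    by rewrite inE !ffunE eqxx neq_vu eqxx addr0.
  by rewrite inE !ffunE eqxx neq_vu (negPf neq_x).
have sub : homs \subset embeddings H G :|: \bigcup_(uv in D) glued uv.
  apply/subsetP=> psi; rewrite !inE => ->; rewrite andbT.
  case: (boolP (injectiveb psi)) => //= /injectivePn[u [v neq_uv eq_psi]].
  by apply/bigcupP; exists (u, v); rewrite inE //= eq_psi.
have le_glued : (#|\bigcup_(uv in D) glued uv| <= \sum_(uv in D) #|glued uv|)%N.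
  apply: (big_ind2 (fun (A : {set {ffun U -> V}}) m => #|A| <= m)%N) => //.
    by rewrite cards0.
  by move=> A m B n leA leB; apply: leq_trans (leq_card_setU A B) (leq_add leA leB).
have := leq_trans (subset_leq_card sub) (leq_card_setU _ _).
move/leq_trans/(_ (leq_add (leqnn _) le_glued)).
rewrite -(leq_pmul2l V_gt0) mulnDr => /leq_trans; apply; rewrite leq_add2l.
rewrite big_distrr /= (eq_bigr _ card_glued) sum_nat_const leq_mul2r.
by rewrite -mulnn -card_prod max_card orbT.
Qed.

Lemma card_embeddings_ge : (4 * #|U| ^ 2 * b ^ #|U| <= #|V| ->
  #|V| ^ #|U| <= 4 * b ^ #|U| * #|embeddings H G|)%N.
Proof.
move=> V_large; rewrite -(leq_pmul2l V_gt0).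
have := card_homs_le; have := card_homs_ge.
move: V_large V_gt0; set n := #|V|; set N := (n ^ _)%N; set B := (b ^ _)%N.
set X := #|homs|; set Y := #|embeddings _ _|; set h2 := (#|U| ^ 2)%N => V_large n_gt0 le1 le2.
have le3 : (n * N <= 2 * B * (n * Y + h2 * N))%N.
  by apply: leq_trans (leq_mul (leqnn _) le1) _; rewrite mulnCA leq_mul.
have le4 : (4 * h2 * B * N <= n * N)%N by rewrite leq_mul.
lia.
Qed.

End RemovalArgument.

(** * The polynomial removal lemma *)

Section Bounds.
Variables (k c m h : nat).
(** Large enough for resampling to delete less than half of the allowed number of
    edges; k ^ k comes from n ^ k <= k ^ k * 'C(n, k), and (m * 2).+1 is the
    inverse of the fraction of tuples that a typical box may miss, where m is the
    number of edges of H. *)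
Definition cluster_scale a := (4 * (k * k ^ k) * (m * 2).+1 * a)%N.
(** Large enough for the edges meeting small cells to fill less than the other
    half, the number of cells being bounded by the packing bound. *)
Definition cell_scale a := (2 * (k * k ^ k) * a * packing_bound c (cluster_scale a)).+1.
(** The two terms are for a vertex set that is large enough for most
    homomorphisms to be injective, and for a smaller one, where one embedding
    suffices. *)
Definition copy_bound a :=
  (4 * cell_scale a ^ h + (4 * h ^ 2 * cell_scale a ^ h) ^ h)%N.
End Bounds.

(** Were the pruned hypergraph H-free, it would contradict the distance
    hypothesis; so it contains a copy of H, which is then moved around inside its
    blocks. *)
Lemma removal (R : realType) (k : nat) (U V : finType) (H : hypergraph k U)
    (G : hypergraph k V) c a (eps : R) :
    growth_bounded (slice (is_edge G)) c -> (0 < a)%N -> a%:R^-1 <= eps ->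
    far eps (hfree H) G ->
  (0 < #|embeddings H G|)%N /\
  (#|V| ^ #|U| <= copy_bound k c #|edges H| #|U| a * #|embeddings H G|)%N.
Proof.
move=> growG a_gt0 le_eps farG.
have eps_gt0 : 0 < eps by apply: lt_le_trans le_eps; rewrite invr_gt0 ltr0n.
have emb_gt0 : (0 < #|embeddings H G|)%N.
  rewrite ltnNge; apply/negP=> emb0.
  have : hfree H V G by move=> /containsP; rewrite ltnNge emb0.
  move=> /farG; rewrite /distance !setDv setU0 cards0 mul0r leNgt.
  by rewrite eps_gt0.
split=> //; set m := #|edges H|; set h := #|U|.
set b := cell_scale k c m a; set X := #|embeddings H G| in emb_gt0 *.
have [V_small|V_large] := leqP #|V| (4 * h ^ 2 * b ^ h).
  rewrite /copy_bound -/b mulnDl; apply: leq_trans (leq_addl _ _).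
  apply: leq_trans (leq_expn2r h V_small) _.
  by rewrite -[leqLHS]muln1 leq_mul.
have V_gt0 : (0 < #|V|)%N by apply: leq_ltn_trans V_large.
set g := (m * 2).+1; set a1 := cluster_scale k m a.
set K := packing_bound c a1.
have [r le_r near_r] := exists_clustering a1 growG.
have cW : #|{: 'I_k * {ffun 'I_k -> V}}| = (k * #|V| ^ k)%N.
  by rewrite card_prod card_ffun card_ord.
(* Two vertices of a cell are both close to its representative, whence the
   factor 2. *)
pose delta : R := (2 * (k * #|V| ^ k))%:R / a1.+1%:R.
have disc_le x y : r x = r y -> (discrepancy (slice (is_edge G)) x y)%:R <= delta.
  move=> eq_r; rewrite ler_pdivlMr ?ltr0n // -natrM ler_nat mulnC.
  apply: leq_trans (leq_mul (leqnn _) (discrepancy_triangle _ x (r x) y)) _.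
  rewrite mulnDr -cW mul2n -addnn leq_add ?near_r //.
  rewrite eq_r /discrepancy (eq_card
      (B := [set z | slice (is_edge G) y z != slice (is_edge G) (r y) z])).
    exact: near_r.
  by move=> z; rewrite !inE eq_sym.
have b_gt0 : (0 < b)%N by [].
pose G' := pruned R G r b g.
have contG' : contains H G'.
  apply/containsP; rewrite ltnNge; apply/negP => emb0.
  have : hfree H V G' by move=> /containsP; rewrite ltnNge emb0.
  move=> /farG; rewrite leNgt => /negP; apply; apply: lt_le_trans le_eps.
  (* With fewer than k vertices the distance is 0. *)
  rewrite /distance; have [lt_nk|le_kn] := ltnP #|V| k.
    by rewrite bin_small // invr0 mulr0 invr_gt0 ltr0n.
  have C_gt0 : (0 < 'C(#|V|, k))%N by rewrite bin_gt0.
  rewrite ltr_pdivrMr ?ltr0n // mulrC ltr_pdivlMr ?ltr0n //.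
  have k_gt0 : (0 < k ^ k)%N by rewrite expn_gt0; case: (k).
  rewrite -(ltr_pM2l (_ : 0 < (k ^ k)%:R)) ?ltr0n //.
  apply: (@lt_le_trans _ _ (#|V| ^ k)%:R); last by rewrite -natrM ler_nat expn_le_bin.
  have := card_pruned_le R G r b g; rewrite -/G' -(ler_nat R) => le_del.
  have := le_trans le_del (card_atypical_le g V_gt0 b_gt0 le_r disc_le).
  set del := #|_|%:R; rewrite /delta -/K natrM (natrM _ k K).
  have N_gt0 : 0 < (#|V| ^ k)%:R :> R by rewrite ltr0n expn_gt0 V_gt0.
  have a1_gt0 : 0 < a1.+1%:R :> R by rewrite ltr0n.
  have bR_gt0 : 0 < b%:R :> R by rewrite ltr0n.
  have kR_gt0 : 0 < (k ^ k)%:R :> R by rewrite ltr0n.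
  have aR_gt0 : 0 < a%:R :> R by rewrite ltr0n.
  have def_a1 : a1.+1%:R = 4 * (k%:R * (k ^ k)%:R) * g%:R * a%:R + 1 :> R.
    by rewrite -natr1 /a1 /cluster_scale !natrM.
  have def_b : b%:R = 2 * (k%:R * (k ^ k)%:R) * a%:R * K%:R + 1 :> R.
    by rewrite /b /cell_scale -natr1 !natrM.
  rewrite natrM; move: N_gt0 a1_gt0 bR_gt0 kR_gt0 aR_gt0 def_a1 def_b.
  move: (#|V| ^ k)%:R a1.+1%:R b%:R (k ^ k)%:R a%:R k%:R g%:R K%:R.
  move=> N A B KK aa kk gg KR N_gt0 A_gt0 B_gt0 KK_gt0 aa_gt0 defA defB le_d.
  apply: le_lt_trans (_ : _ <= KK * ((gg * (2 * (kk * N) / A) + kk * KR * N / B) * aa)) _.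
    by rewrite ler_pM2l // ler_pM2r.
  (* Both error terms are just below half of the allowed total. *)
  have -> : KK * ((gg * (2 * (kk * N) / A) + kk * KR * N / B) * aa) =
     N * ((A - 1) / (2 * A) + (B - 1) / (2 * B)).
    by rewrite defA defB; field; rewrite -defA -defB !gt_eqF.
  rewrite -[ltRHS]mulr1 ltr_pM2l //.
  have -> : (A - 1) / (2 * A) = 2^-1 - A^-1 / 2 by field; rewrite gt_eqF.
  have -> : (B - 1) / (2 * B) = 2^-1 - B^-1 / 2 by field; rewrite gt_eqF.
  have iA : 0 < A^-1 by rewrite invr_gt0.
  have iB : 0 < B^-1 by rewrite invr_gt0.
  lra.
have [f _ f_emb] := contG'.
have := card_embeddings_ge V_gt0 b_gt0 f_emb (ltnSn _) (ltnW V_large).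
by move/leq_trans; apply; rewrite /copy_bound -/b leq_mul // leq_addr.
Qed.

(** * The sampling tester *)

Lemma prob_output_total (R : realType) k n (G : hypergraph k 'I_n) A :
  prob_output R G true A + prob_output R G false A = 1.
Proof.
elim: A => [b|u next IH|m next IH] /=; first by case: b; rewrite /= ?addr0 ?add0r.
  exact: IH.
rewrite -mulrDl -big_split (eq_bigr (fun _ => 1)) => [|i _]; last exact: IH.
by rewrite sumr_const card_ord divff // pnatr_eq0.
Qed.

Section SamplingTester.
Variables (k : nat) (U : finType) (H : hypergraph k U).

Definition edge_tuples : seq (k.-tuple U) :=
  pmap insub [seq enum (e : {set U}) | e in edges H].

Lemma size_edge_tuples : (size edge_tuples <= #|edges H|)%N.
Proof.
by rewrite size_pmap (leq_trans (count_size _ _)) // ?size_map -?cardE.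
Qed.

Fixpoint query_all n (us : seq (k.-tuple 'I_n)) (yes no : algorithm k n) :=
  if us is u :: us' then
    Query u (fun b => if b then query_all us' yes no else no)
  else yes.

Definition trial n (psi : {ffun U -> 'I_n}) (next : algorithm k n) :=
  if injectiveb psi
  then query_all [seq map_tuple psi u | u <- edge_tuples] (Output k n false) next
  else next.

(** When no map from U to 'I_n exists there is nothing to draw from, and no
    copy of H to find. *)
Fixpoint sampling_tester s n : algorithm k n :=
  if s is s'.+1 then
    if enum {ffun U -> 'I_n} is psi0 :: psis then
      Draw (fun i : 'I_(size psis).+1 =>
        trial (nth psi0 (psi0 :: psis) i) (sampling_tester s' n))
    else Output k n true
  else Output k n true.

Lemma query_complexity_query_all n us (yes no : algorithm k n) :
  (query_complexity (query_all us yes no)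
    <= size us + maxn (query_complexity yes) (query_complexity no))%N.
Proof.
elim: us => [|u us IH] /=; first exact: leq_maxl.
rewrite ltnS; apply/bigmax_leqP=> -[] _ //.
by rewrite (leq_trans (leq_maxr (query_complexity yes) _)) // leq_addl.
Qed.

Lemma query_complexity_sampling_tester s n :
  (query_complexity (sampling_tester s n) <= s * #|edges H|)%N.
Proof.
elim: s => // s IH /=; case: (enum _) => // psi0 psis /=.
apply/bigmax_leqP => i _; rewrite /trial mulSn; case: ifP => _; last first.
  exact: leq_trans IH (leq_addl _ _).
apply: leq_trans (query_complexity_query_all _ _ _) _.
by rewrite max0n size_map leq_add ?size_edge_tuples.
Qed.

Variable R : realType.

Lemma prob_query_all n (G : hypergraph k 'I_n) b us (yes no : algorithm k n) :
  prob_output R G b (query_all us yes no) =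
  prob_output R G b (if all (adjacent G) us then yes else no).
Proof. by elim: us => //= u us IH; case: (adjacent G u). Qed.

Lemma all_adjacent_edge_tuples n (G : hypergraph k 'I_n) (psi : {ffun U -> 'I_n}) :
  all (adjacent G) [seq map_tuple psi u | u <- edge_tuples]
    = [forall e in edges H, psi @: e \in edges G].
Proof.
have adj (u : k.-tuple U) (e : {set U}) : tval u = enum e ->
    adjacent G (map_tuple psi u) = (psi @: e \in edges G).
  move=> def_u; rewrite /adjacent.
  suff -> : [set x in map_tuple psi u] = psi @: e by [].
  apply/setP=> x; rewrite inE memtE /= def_u.
  by apply/mapP/imsetP => -[y]; [rewrite mem_enum => ey ->; exists y |
    move=> ey ->; exists y; rewrite ?mem_enum].
rewrite all_map; apply/allP/forall_inP => [adjH e He | adjH u].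
  have sz_e : size (enum e) == k by rewrite -cardE (card_edge He).
  rewrite -(adj (Tuple sz_e)) //; apply: adjH.
  by rewrite mem_pmap_sub; apply/imageP; exists e.
rewrite mem_pmap_sub => /imageP[e He def_u]; rewrite /= (adj _ _ def_u).
exact: adjH.
Qed.

Lemma prob_trial n (G : hypergraph k 'I_n) b psi next :
  prob_output R G b (trial psi next) =
  prob_output R G b (if psi \in embeddings H G then Output k n false else next).
Proof.
rewrite /trial inE; case: ifP => // _.
by rewrite prob_query_all all_adjacent_edge_tuples.
Qed.

(** The rounds are independent, and each one rejects exactly when it draws an
    embedding. *)
Lemma prob_sampling_tester s n (G : hypergraph k 'I_n) :
  prob_output R G true (sampling_tester s n) =
  (1 - #|embeddings H G|%:R / #|{ffun U -> 'I_n}|%:R) ^+ s.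
Proof.
elim: s => [|s IH]; first by rewrite expr0.
have def_maps := cardE {ffun U -> 'I_n}.
have big_maps (F : {ffun U -> 'I_n} -> R) :
    \sum_(psi <- enum {ffun U -> 'I_n}) F psi = \sum_psi F psi.
  by rewrite big_enum.
move: def_maps big_maps; rewrite /=; case def_enum: (enum _) => [|psi0 psis] cardM big_maps.
  have -> : #|embeddings H G| = 0%N.
    by apply/eqP; rewrite -leqn0 -[0%N]/(size (Nil {ffun U -> 'I_n})) -cardM max_card.
  by rewrite mul0r subr0 expr1n.
rewrite /= exprS -IH.
under eq_bigr => i _ do rewrite prob_trial.
have reindex_maps (F : {ffun U -> 'I_n} -> R) :
    \sum_(i < (size psis).+1) F (nth psi0 (psi0 :: psis) i) = \sum_psi F psi.
  by rewrite -big_maps (big_nth psi0) big_mkord.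
rewrite (reindex_maps (fun psi => prob_output R G true
  (if psi \in embeddings H G then Output k n false else sampling_tester s n))).
have M_neq0 : #|{ffun U -> 'I_n}|%:R != 0 :> R by rewrite cardM pnatr_eq0.
rewrite -[(size psis).+1]/(size (psi0 :: psis)) -cardM.
rewrite (bigID (mem (embeddings H G))) /= big1 ?add0r => [|psi ->] //.
rewrite (eq_bigr (fun _ => prob_output R G true (sampling_tester s n))) => [|psi /negPf->] //.
have cardC :
    #|embeddings H G|%:R + #|[predC embeddings H G]|%:R = #|{ffun U -> 'I_n}|%:R :> R.
  by rewrite -natrD cardC.
rewrite sumr_const -[_ *+ _]mulr_natl mulrAC; congr (_ * _).
have -> : 1 - #|embeddings H G|%:R / #|{ffun U -> 'I_n}|%:R
    = (#|{ffun U -> 'I_n}|%:R - #|embeddings H G|%:R) / #|{ffun U -> 'I_n}|%:R :> R.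
  by rewrite mulrBl divff.
by rewrite -{2}cardC addrC addKr; congr (_%:R / _).
Qed.

End SamplingTester.

(** The bounds above are functions of a natural number a of order 1 / eps; this
    predicate collects them into one polynomial. *)
Definition poly_bounded (F : nat -> nat) :=
  exists C E, forall a, (F a <= C * a.+1 ^ E)%N.

Lemma poly_bounded_const C : poly_bounded (fun _ => C).
Proof. by exists C, 0%N => a; rewrite expn0 muln1. Qed.

Lemma poly_bounded_id : poly_bounded id.
Proof. by exists 1%N, 1%N => a; rewrite mul1n expn1. Qed.

Lemma poly_boundedD F1 F2 : poly_bounded F1 -> poly_bounded F2 ->
  poly_bounded (fun a => F1 a + F2 a)%N.
Proof.
move=> [C1 [E1 le1]] [C2 [E2 le2]]; exists (C1 + C2)%N, (E1 + E2)%N => a.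
rewrite mulnDl leq_add //; [apply: leq_trans (le1 a) _ | apply: leq_trans (le2 a) _].
  by rewrite leq_mul // leq_pexp2l // leq_addr.
by rewrite leq_mul // leq_pexp2l // leq_addl.
Qed.

Lemma poly_boundedM F1 F2 : poly_bounded F1 -> poly_bounded F2 ->
  poly_bounded (fun a => F1 a * F2 a)%N.
Proof.
move=> [C1 [E1 le1]] [C2 [E2 le2]]; exists (C1 * C2)%N, (E1 + E2)%N => a.
by rewrite expnD mulnACA leq_mul.
Qed.

Lemma poly_boundedS F : poly_bounded F -> poly_bounded (fun a => (F a).+1).
Proof.
move=> bF; have [C [E le]] := poly_boundedD bF (poly_bounded_const 1).
by exists C, E => a; rewrite -addn1.
Qed.

Lemma poly_boundedX F e : poly_bounded F -> poly_bounded (fun a => F a ^ e)%N.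
Proof.
move=> bF; elim: e => [|e IH]; first exact: poly_bounded_const.
have [C [E le]] := poly_boundedM bF IH.
by exists C, E => a; rewrite expnS.
Qed.

Lemma poly_bounded_copy_bound k c m h : poly_bounded (copy_bound k c m h).
Proof.
have b_scale : poly_bounded (cluster_scale k m).
  exact: poly_boundedM (poly_bounded_const _) poly_bounded_id.
have b_pack : poly_bounded (fun a => packing_bound c (cluster_scale k m a)).
  apply/poly_boundedX/poly_boundedS/poly_boundedX.
  exact: poly_boundedM (poly_boundedS b_scale) (poly_bounded_const _).
have b_cell : poly_bounded (cell_scale k c m).
  apply/poly_boundedS/poly_boundedM => //.
  exact: poly_boundedM (poly_bounded_const _) poly_bounded_id.
have b_pow C : poly_bounded (fun a => C * cell_scale k c m a ^ h)%N.
  exact: poly_boundedM (poly_bounded_const _) (poly_boundedX _ b_cell).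
by apply: poly_boundedD (b_pow _) (poly_boundedX _ (b_pow _)).
Qed.

(** The probability of missing in one round is at most 1 - 1 / c, and
    (1 - 1 / c) ^ (2 c) <= 1 / 4. *)
Lemma miss_probability_le (R : realFieldType) (N X c : nat) :
    (0 < N)%N -> (X <= N)%N -> (N <= c * X)%N ->
  (1 - X%:R / N%:R) ^+ (2 * c) <= 3^-1 :> R.
Proof.
move=> N_gt0 le_XN le_N; have N_gt0R : 0 < N%:R :> R by rewrite ltr0n.
case: c le_N => [|c le_N]; first by rewrite mul0n leqNgt N_gt0.
have miss_ge0 : 0 <= 1 - X%:R / N%:R :> R.
  by rewrite subr_ge0 ler_pdivrMr // mul1r ler_nat.
have miss_le : 1 - X%:R / N%:R <= c%:R / c.+1%:R :> R.
  rewrite lerBlDr -lerBlDl (_ : 1 - c%:R / c.+1%:R = c.+1%:R^-1); last first.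
    apply: (canLR (addrK _)); apply: (@mulIf _ c.+1%:R); first by rewrite pnatr_eq0.
    by rewrite mul1r mulrDl mulVf ?divfK ?pnatr_eq0 // addrC natr1.
  by rewrite ler_pdivlMr // mulrC ler_pdivrMr ?ltr0n // -natrM ler_nat mulnC.
apply: le_trans (lerXn2r _ miss_ge0 (divr_ge0 (ler0n _ _) (ler0n _ _)) miss_le) _.
rewrite expr_div_n ler_pdivrMr ?exprn_gt0 ?ltr0n // -!natrX.
rewrite mulrC ler_pdivlMr ?ltr0n // -natrM ler_nat mulnC.
rewrite [(2 * _)%N]mulnC; apply: leq_trans (two_expn_le c 2).
by rewrite leq_mul.
Qed.

Theorem corollary1p7 (R : realType) (k : nat) (U : finType)
    (H : hypergraph k U) (d t D : nat)
    (hd : (0 < d)%N) (ht : (0 < t)%N) (hD : (0 < D)%N) :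
  easily_testable R (hfree H) (@semialgebraic R k d t D).
Proof.
pose c := slice_exponent k d t D.
pose rounds a := (2 * copy_bound k c #|edges H| #|U| a)%N.
have [C [E rounds_le]] : poly_bounded (fun a => rounds a * #|edges H|)%N.
  apply: poly_boundedM (poly_bounded_const _).
  exact: poly_boundedM (poly_bounded_const _) (poly_bounded_copy_bound _ _ _ _).
exists (C%:R *: ('X + 2%:P) ^+ E) => eps eps_gt0.
(* A natural number of order 1 / eps, with 1 / a <= eps; the query bound is
   polynomial in a.+1 <= 1 / eps + 2. *)
pose a := (Num.truncn eps^-1).+1.
have inv_ge0 : 0 <= eps^-1 by rewrite invr_ge0 ltW.
have /andP[a_ge a_gt] := truncn_itv inv_ge0.
have a_le : a%:R^-1 <= eps.
  by rewrite -[leRHS]invrK lef_pV2 ?posrE ?invr_gt0 ?ltr0n // ltW.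
exists (sampling_tester H (rounds a)).
have prob_free n (G : hypergraph k 'I_n) : hfree H 'I_n G ->
    prob_output R G true (sampling_tester H (rounds a) n) = 1.
  move=> freeG; rewrite prob_sampling_tester.
  have [emb0|emb_gt0] := posnP #|embeddings H G|.
    by rewrite emb0 mul0r subr0 expr1n.
  by case: freeG; apply/containsP.
split=> [n G semG||n].
- split=> [/prob_free-> | farG]; first by lra.
  have growG := semialgebraic_growth semG.
  have [emb_gt0 le_emb] := removal growG (ltn0Sn _) a_le farG.
  have cardM : #|{ffun U -> 'I_n}| = (#|'I_n| ^ #|U|)%N by rewrite card_ffun.
  have le_M := max_card (embeddings H G).
  have M_gt0 : (0 < #|{ffun U -> 'I_n}|)%N by apply: leq_trans le_M.
  rewrite -cardM in le_emb.
  have := miss_probability_le R M_gt0 le_M le_emb.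
  have := prob_output_total R G (sampling_tester H (rounds a) n).
  rewrite prob_sampling_tester -/(rounds a).
  set x := _ ^+ _; set y := prob_output _ _ _ _; lra.
- by move=> n G _; apply: prob_free.
apply: (@le_trans _ _ (C * a.+1 ^ E)%:R).
  by rewrite ler_nat (leq_trans (query_complexity_sampling_tester _ _ _)).
have a_upper : a.+1%:R <= eps^-1 + 2.
  by rewrite /a -addn2 natrD lerD2r.
rewrite hornerZ horner_exp hornerD hornerX hornerC natrM natrX ler_wpM2l //.
by apply: lerXn2r a_upper; rewrite nnegrE; [exact: ler0n | exact: addr_ge0].
Qed.
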